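(* Consider the observation system $\dot z(t)-iAz(t)=0$ $(t>0)$, $z(0)=z_0\in X$, $y(t)=Cz(t)$ $(t>0)$ described in the context. The system is weakly observable if and only if $C$ is spectrally coercive, that is, the following two assertions are equivalent. (1) There exist $\varepsilon,\psi\in\mathfrak C$ such that, if $z\in X_2\setminus\{0\}$ satisfies $$0\le \frac{\|Az\|_X^2}{\|z\|_X^2}-\lambda^2(z)<\varepsilon(\lambda(z)),$$ then $$\|Cz\|_Y^2\ge \psi(\lambda(z))\,\|z\|_X^2 .$$ (2) The following weak observation inequality holds: for all $z_0\in X_2\setminus\{0\}$, $$\theta_2\,\psi\!\left(\theta_0\left(\tfrac1T+\lambda(z_0)\right)\right)\|z_0\|_X^2\le \int_0^T\|Cz(t)\|_Y^2\,dt$$ for all $T\ge T(\lambda(z_0))$, where $z(t)=e^{itA}z_0$, where $T(\lambda(z_0))$ is the unique solution $T$ of the equation $$T\,\varepsilon\!\left(\theta_0\left(\tfrac1T+\lambda(z_0)\right)\right)=\theta_1,$$ and where $\varepsilon,\psi\in\mathfrak C$ are the functions appearing in the spectral coercivity of $C$ (that is, those of assertion (1)). The strictly positive constants $\theta_i$, $i=0,1,2$, do not depend on the parameters of the observability system. In addition, the function $\lambda\mapsto T(\lambda)$ is increasing.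
   Context: $X$ and $Y$ are complex Hilbert spaces. $A$ is a linear unbounded self-adjoint, strictly positive operator on $X$ with compact resolvent. $X_2=D(A)$ with the norm $\|z\|_2=\|Az\|_X$, and $(e^{itA})_{t\in\mathbb R}$ is the strongly continuous group of isometries of $X$ generated by $iA$. $C\in\mathcal L(X_2,Y)$ is a bounded linear operator from $X_2$ to $Y$, assumed admissible: for every $T>0$ there is $C_T>0$ (without loss of generality an increasing function of $T$) such that $\int_0^T\|Ce^{itA}z_0\|_Y^2\,dt\le C_T\|z_0\|_X^2$ for all $z_0\in X_2$. For $z\in X_2\setminus\{0\}$ the $A$-frequency is $\lambda(z)=\langle Az,z\rangle_X\|z\|_X^{-2}$. $\mathfrak C$ is the set of continuous decreasing functions $\psi:\mathbb R_+\to\mathbb R_+^*=(0,\infty)$, where $\mathbb R_+=[0,\infty)$. Here and in the claim, ''decreasing'' and ''increasing'' are understood in the non-strict sense (constant functions belong to $\mathfrak C$). The system is called weakly observable in time $T>0$ if there exists $\psi\in\mathfrak C$ such that $\psi(\lambda(z_0))\|z_0\|_X^2\le\int_0^T\|Ce^{itA}z_0\|_Y^2\,dt$ for all $z_0\in X_2\setminus\{0\}$; the function $\psi$ may depend on $T$. $C$ is called spectrally coercive if there exist functions $\varepsilon,\psi\in\mathfrak C$ such that, whenever $z\in X_2\setminus\{0\}$ satisfies $\frac{\|Az\|_X^2}{\|z\|_X^2}-\lambda^2(z)<\varepsilon(\lambda(z))$, one has $\|Cz\|_Y^2\ge\psi(\lambda(z))\|z\|_X^2$.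
   Formalization: θ0 and θ2 are absolute, but θ1 may depend on an upper bound M of ε(0), and (1)⇒(2) with the same functions is stated for ε(0)≤M; fully uniform constants fail for C=id, ψ=1, ε≡M large, where (2) at T=θ1/M would give θ2≤θ1/M. *)

(* Defs.v *)
From HB Require Import structures.
From mathcomp Require Import all_boot all_order all_algebra.
From mathcomp Require Import complex.
From mathcomp Require Import all_classical all_reals all_analysis.

Set Implicit Arguments.
Unset Strict Implicit.
Unset Printing Implicit Defensive.

Import Order.TTheory GRing.Theory Num.Theory.
Import numFieldNormedType.Exports.

Local Open Scope classical_set_scope.
Local Open Scope complex_scope.
Local Open Scope ring_scope.

(* The norm of a normed module over R[i] takes its values in R[i];
   rnorm is the same norm, read in R. *)
Definition rnorm (R : realType) (V : normedModType R[i]) (x : V) : R :=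
  complex.Re `|x|.

(* Together with the completeness of V, this makes V a complex Hilbert space;
   the scalar product is linear in its first argument. *)
Definition is_hilbert_dot (R : realType) (V : completeNormedModType R[i])
    (dot : {dot V for Num.conj}) : Prop :=
  forall x, dot x x = `|x| ^+ 2.

(* An unbounded operator is a pair (D, A) of a domain D and a function A whose
   values outside D are irrelevant. *)
Section UnboundedOperators.
Context {R : realType} {X : completeNormedModType R[i]}.
Variables (dot : {dot X for Num.conj}) (D : set X) (A : X -> X).

Definition linear_on (V : lmodType R[i]) (f : X -> V) : Prop :=
  forall (a : R[i]) x y, D x -> D y -> f (a *: x + y) = a *: f x + f y.

Definition is_subspace : Prop :=
  D 0 /\ forall (a : R[i]) x y, D x -> D y -> D (a *: x + y).

(* The right-hand side says that (y, w) is in the graph of the adjoint of A. *)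
Definition self_adjoint : Prop :=
  [/\ is_subspace, linear_on A, dense D &
      forall y w, (D y /\ A y = w) <->
                  (forall x, D x -> dot (A x) y = dot x w)].

Definition strictly_positive : Prop :=
  exists2 m : R, 0 < m &
    forall z, D z -> m * rnorm z ^+ 2 <= complex.Re (dot (A z) z).

Definition compact_operator (S : X -> X) : Prop :=
  compact (closure (S @` [set x | rnorm x <= 1])).

Definition is_resolvent (mu : R[i]) (S : {linear X -> X}) : Prop :=
  [/\ continuous S,
      forall x, D (S x) /\ A (S x) - mu *: S x = x &
      forall x, D x -> S (A x - mu *: x) = x].

Definition has_compact_resolvent : Prop :=
  exists mu S, is_resolvent mu S /\ compact_operator S.

Definition isometry_C0_group (U : R -> {linear X -> X}) : Prop :=
  [/\ forall x, U 0 x = x,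
      forall s t x, U (s + t) x = U s (U t x),
      forall t x, `|U t x| = `|x| &
      forall x, continuous (fun t => U t x)].

(* The generator of U is iA, domains included. *)
Definition generated_by_i (U : R -> {linear X -> X}) : Prop :=
  forall z w, (D z /\ w = 'i *: A z) <->
    ((fun h : R => (h^-1)%:C *: (U h z - z)) @ 0^' --> w).

End UnboundedOperators.

Section Integral.
Context {R : realType} {X Y : completeNormedModType R[i]}.

Definition output_energy (U : R -> {linear X -> X}) (C : X -> Y)
    (T : R) (z0 : X) : \bar R :=
  (\int[lebesgue_measure]_(t in `[0%R, T]) (rnorm (C (U t z0)) ^+ 2)%:E)%E.

End Integral.

(* The system z' - iAz = 0, z(0) = z0, y = Cz. Here obs_U t is e^{itA}, and
   the values of obs_C outside D(A) are irrelevant. *)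
Record obs_system (R : realType) := ObsSystem {
  obs_X : completeNormedModType R[i];
  obs_Y : completeNormedModType R[i];
  obs_dotX : {dot obs_X for Num.conj};
  obs_dotY : {dot obs_Y for Num.conj};
  obs_D : set obs_X;
  obs_A : obs_X -> obs_X;
  obs_U : R -> {linear obs_X -> obs_X};
  obs_C : obs_X -> obs_Y;
  obs_hilbertX : is_hilbert_dot obs_dotX;
  obs_hilbertY : is_hilbert_dot obs_dotY;
  obs_self_adjoint : self_adjoint obs_dotX obs_D obs_A;
  obs_positive : strictly_positive obs_dotX obs_D obs_A;
  obs_compact : has_compact_resolvent obs_D obs_A;
  obs_group : isometry_C0_group obs_U;
  obs_generator : generated_by_i obs_D obs_A obs_U;
  obs_C_linear : linear_on obs_D obs_C;
  obs_C_bounded : exists K : R, forall z, obs_D z ->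
    rnorm (obs_C z) <= K * rnorm (obs_A z);
  obs_admissible : forall T : R, 0 < T -> exists2 CT : R, 0 < CT &
    forall z0, obs_D z0 ->
      (output_energy obs_U obs_C T z0 <= (CT * rnorm z0 ^+ 2)%:E)%E }.

Section Observability.
Context {R : realType}.
Implicit Types (S : obs_system R) (eps psi : R -> R).

Definition frequency S (z : obs_X S) : R :=
  complex.Re (obs_dotX S (obs_A z) z) / rnorm z ^+ 2.

(* The class of functions from [0, +oo[ to ]0, +oo[ used as moduli; the values
   at negative arguments are irrelevant. *)
Definition modulus psi : Prop :=
  [/\ {within `[0, +oo[, continuous psi},
      forall x y, 0 <= x -> x <= y -> psi y <= psi x &
      forall x, 0 <= x -> 0 < psi x].

Definition weakly_observable_in S (T : R) : Prop :=
  exists2 psi, modulus psi &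
    forall z0 : obs_X S, obs_D z0 -> z0 != 0 ->
      ((psi (frequency z0) * rnorm z0 ^+ 2)%:E
         <= output_energy (@obs_U _ S) (@obs_C _ S) T z0)%E.

Definition weakly_observable S : Prop :=
  exists2 T : R, 0 < T & weakly_observable_in S T.

Definition coercive_with S eps psi : Prop :=
  forall z : obs_X S, obs_D z -> z != 0 ->
    0 <= rnorm (obs_A z) ^+ 2 / rnorm z ^+ 2 - frequency z ^+ 2
      < eps (frequency z) ->
    psi (frequency z) * rnorm z ^+ 2 <= rnorm (obs_C z) ^+ 2.

Definition spectrally_coercive S : Prop :=
  exists eps psi, [/\ modulus eps, modulus psi & coercive_with S eps psi].

Definition solves_time_eq (theta0 theta1 : R) eps (lambda T : R) : Prop :=
  0 < T /\ T * eps (theta0 * (T^-1 + lambda)) = theta1.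

(* The solution of the equation above, chosen when one exists. *)
Definition obs_time (theta0 theta1 : R) eps (lambda : R) : R :=
  get [set T | solves_time_eq theta0 theta1 eps lambda T].

Definition weak_obs_inequality (theta0 theta1 theta2 : R) S eps psi : Prop :=
  forall z0 : obs_X S, obs_D z0 -> z0 != 0 ->
  forall T : R, obs_time theta0 theta1 eps (frequency z0) <= T ->
    ((theta2 * psi (theta0 * (T^-1 + frequency z0)) * rnorm z0 ^+ 2)%:E
       <= output_energy (@obs_U _ S) (@obs_C _ S) T z0)%E.

End Observability.

(* Main.v *)
Require Import Defs.
From HB Require Import structures.
From mathcomp Require Import all_boot all_order all_algebra.
From mathcomp Require Import complex.
From mathcomp Require Import all_classical all_reals all_analysis.
From mathcomp Require Import ring lra zify.

Set Implicit Arguments.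
Unset Strict Implicit.
Unset Printing Implicit Defensive.

Import Order.TTheory GRing.Theory Num.Theory.
Import numFieldNormedType.Exports.
Local Open Scope classical_set_scope.
Local Open Scope complex_scope.
Local Open Scope ring_scope.

(* Let z(t) = e^{itA} z. The spectral decomposition of z is replaced by the
   discrete Fourier transform X_k of the samples chi_j z(jh), j < N, T = N h.
   By Parseval, sum |B X_k|^2 is a weighted mean of the |B z(jh)|^2 for B = 1 and
   B = C, and sum <A X_k, X_k> = <A z, z>; moreover (A - s_k) X_k is small for
   some complex numbers s_k, with a total square norm of order 1 / T^2 as h -> 0.
   A packet X_k either satisfies the coercivity inequality, or has a frequency
   above 4 lambda(z), or a variance above eps. The last two cases carry at most
   a fixed fraction of |z|^2 as soon as T^2 eps >= 480, hence the observation
   inequality, as Riemann sums of the output converge to its energy. Since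
   eps <= M, the condition T eps >= theta1 implies both T >= 1 and
   T^2 eps >= 480.

   Conversely, C z(t) differs from e^{it lambda} C z by a term which
   admissibility bounds by |(A - lambda) z|, so an observation inequality on
   vectors of bounded frequency gives coercivity on these vectors. The moduli
   are recovered from one constant per integer frequency level.

   Observability in a time independent of the frequency uses A >= 0. On the
   half-line mu >= 0, e^{i a mu} is a limit of combinations of the e^{i t mu},
   0 <= t <= 1, even for large a, in the weight 1 + mu. Indeed, if x_0 = sin t and
   x_{k+1} = 4 x_k (1 - x_k), then x_k has frequencies at most 2^k, slope 4^k at 0
   and values in [0, 1] on [0, pi]; a large power of 1 + (e^{i phi} - 1) x_k(t),
   damped beyond pi, is bounded by 1 on the half-line and rotates about 2^k times
   faster than its bandwidth allows on the whole line. *)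

(** * Complex exponentials *)

Section ComplexScalars.
Context {R : realType}.
Implicit Types (x y : R) (z w : R[i]).

Lemma imagE : 'i = (0 +i* 1)%C :> R[i].
Proof. by []. Qed.

Lemma gtr0c x : (0 < x%:C) = (0 < x). Proof. exact: (ltcR 0). Qed.

Lemma normc_ge0 z : 0 <= Normc.normc z.
Proof. by case: z => a b; exact: sqrtr_ge0. Qed.

Lemma normcD z w : Normc.normc (z + w) <= Normc.normc z + Normc.normc w.
Proof. exact: le_normcD. Qed.

Lemma normcX z n : Normc.normc (z ^+ n) = Normc.normc z ^+ n.
Proof.
elim: n => [|n IH]; first by rewrite !expr0 Normc.normc1.
by rewrite !exprS Normc.normcM IH.
Qed.

Lemma normc_real x : Normc.normc x%:C = `|x|.
Proof. by rewrite /= expr0n /= addr0 sqrtr_sqr. Qed.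

Lemma normc_sq z : Normc.normc z ^+ 2 = complex.Re z ^+ 2 + complex.Im z ^+ 2.
Proof. by case: z => a b /=; rewrite sqr_sqrtr ?addr_ge0 ?sqr_ge0. Qed.

Lemma normc_geIm z : `|complex.Im z| <= Normc.normc z.
Proof.
rewrite -(@ler_pXn2r _ 2) ?nnegrE ?normc_ge0// normc_sq real_normK ?num_real//.
by rewrite lerDr sqr_ge0.
Qed.

Lemma normc_sum n (f : nat -> R[i]) :
  Normc.normc (\sum_(j < n) f j) <= \sum_(j < n) Normc.normc (f j).
Proof.
elim: n => [|n IH]; first by rewrite !big_ord0 Normc.normc0.
by rewrite !big_ord_recr /=; apply: le_trans (normcD _ _) _; rewrite lerD2r.
Qed.

Definition expi x : R[i] := (cos x +i* sin x)%C.

Lemma expi0 : expi 0 = 1. Proof. by rewrite /expi cos0 sin0. Qed.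

Lemma expiD x y : expi (x + y) = expi x * expi y.
Proof.
rewrite /expi cosD sinD; apply/eqP; rewrite eq_complex /= eqxx /=.
by apply/eqP; ring.
Qed.

Lemma expiX x n : expi x ^+ n = expi (n%:R * x).
Proof.
elim: n => [|n IH]; first by rewrite expr0 mul0r expi0.
by rewrite exprS IH -expiD; congr expi; rewrite -natr1; ring.
Qed.

Lemma normc_expi x : Normc.normc (expi x) = 1.
Proof. by rewrite /expi /= cos2Dsin2 sqrtr1. Qed.

Lemma conj_expi x : (expi x)^* = expi (- x).
Proof. by rewrite /expi cosN sinN. Qed.

Lemma expi_neq1 x : 0 < x < pi *+ 2 -> expi x != 1.
Proof.
move=> /andP[x0 x2]; apply/eqP => -[c1 _].
have inj y : 0 < y -> y <= pi -> cos y <> 1.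
  move=> y0 yp cy; have : y = 0.
    by apply: cos_inj; rewrite ?in_itv /= ?lexx ?pi_ge0 ?(ltW y0) ?yp // cos0.
  by move=> y00; rewrite y00 ltxx in y0.
case: (lerP x pi) => xp; first exact: (inj x).
apply: (inj (pi *+ 2 - x)); [lra| |].
  by rewrite mulr2n; lra.
by rewrite cosB cos2pi sin2pi c1; ring.
Qed.

End ComplexScalars.

Section TrigBounds.
Context {R : realType}.
Implicit Types x : R.

Lemma sin_mvt x : 0 <= x -> exists2 c, 0 <= c <= x & sin x = cos c * x.
Proof.
move=> x0; have [|c] := @MVT_segment R sin cos 0 x x0.
  by apply: continuous_subspaceT; exact: continuous_sin.
by rewrite in_itv /= sin0 !subr0 => cx E; exists c.
Qed.

Lemma normr_sin_le x : `|sin x| <= `|x|.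
Proof.
have pos (y : R) : 0 <= y -> `|sin y| <= `|y|.
  by move=> y0; have [c _ ->] := sin_mvt y0; rewrite normrM ler_piMl// cos_max.
have [/pos//|x0] := lerP 0 x.
by rewrite -normrN -sinN -[leRHS]normrN; apply: pos; rewrite oppr_ge0 ltW.
Qed.

Lemma cos_ge x : 1 - x ^+ 2 / 2 <= cos x.
Proof.
have -> : cos x = 1 - 2 * sin (x / 2) ^+ 2.
  rewrite {1}(_ : x = (x / 2) *+ 2); last by rewrite mulr2n; lra.
  by rewrite cos_mulr2n cos2sin2 mulr2n; ring.
have := normr_sin_le (x / 2).
rewrite -ler_sqr ?nnegrE// !real_normK ?num_real//; lra.
Qed.

Lemma sin_ge_half x : 0 <= x <= 1 -> x / 2 <= sin x.
Proof.
move=> /andP[x0 x1]; have [c /andP[c0 cx] ->] := sin_mvt x0.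
have := cos_ge c; have : c ^+ 2 <= 1 by rewrite expr_le1// (le_trans cx).
by nra.
Qed.

(** The real and the imaginary part are each at most [x ^+ 2 / 2]; for the imaginary part a cubic
    bound is degraded using [|x| <= 1]. Negative [x] follow by conjugation. *)
Lemma expi_second_order x : `|x| <= 1 ->
  Normc.normc (expi x - 1 - (0 +i* x)%C) <= x ^+ 2.
Proof.
have pos (y : R) : 0 <= y -> y <= 1 -> Normc.normc (expi y - 1 - (0 +i* y)%C) <= y ^+ 2.
  move=> y0 y1; rewrite -ler_sqr ?nnegrE ?normc_ge0 ?sqr_ge0// normc_sq /=.
  have [c /andP[c0 cy] ->] := sin_mvt y0.
  have := cos_ge c; have := cos_ge y; have := cos_le1 y; have := cos_le1 c.
  rewrite !subr0.
  have : c ^+ 2 <= y ^+ 2 by rewrite ler_sqr.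
  move: (cos c) (cos y) => a b h1 h2 h3 h4 h5.
  have e1 : (b - 1) ^+ 2 <= (y ^+ 2 / 2) ^+ 2.
    rewrite -sqrrN ler_sqr ?nnegrE; lra.
  have e2 : (a * y - y) ^+ 2 <= (y ^+ 2 / 2) ^+ 2.
    have -> : a * y - y = - (y * (1 - a)) by ring.
    have y2 := sqr_ge0 y; rewrite sqrrN ler_sqr ?nnegrE ?divr_ge0//; last first.
      by rewrite mulr_ge0// subr_ge0.
    have h6 : y * (1 - a) <= y * (y ^+ 2 / 2) by rewrite ler_wpM2l//; lra.
    apply: le_trans h6 _; have : y * y ^+ 2 <= y ^+ 2 by rewrite ler_piMl ?sqr_ge0.
    lra.
  have := sqr_ge0 (y ^+ 2); lra.
move=> x1; have [x0|x0] := lerP 0 x; first by apply: pos => //; rewrite -(ger0_norm x0).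
have := pos (- x); rewrite oppr_ge0 sqrrN => /(_ (ltW x0)).
rewrite -(ltr0_norm x0) => /(_ x1); rewrite (ltr0_norm x0); apply: le_trans.
by rewrite le_eqVlt /expi /= cosN sinN; apply/orP; left; apply/eqP; congr Num.sqrt; ring.
Qed.

End TrigBounds.

(** * Norms, scalar products and the discrete Parseval identity *)

Section RnormTheory.
Context {R : realType} {V : normedModType R[i]}.
Implicit Types (x y : V) (a : R[i]).

Lemma rnormE x : `|x| = (rnorm x)%:C.
Proof. by rewrite /rnorm RRe_real// ger0_real. Qed.

Lemma rnorm_ge0 x : 0 <= rnorm x.
Proof. by rewrite -ler0c -rnormE. Qed.

Lemma rnormD x y : rnorm (x + y) <= rnorm x + rnorm y.
Proof. by rewrite -lecR rmorphD /= -!rnormE ler_normD. Qed.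

Lemma rnormN x : rnorm (- x) = rnorm x.
Proof. by rewrite /rnorm normrN. Qed.

Lemma rnormZ a x : rnorm (a *: x) = Normc.normc a * rnorm x.
Proof. by apply: complexI; rewrite rmorphM /= -!rnormE normrZ. Qed.

Lemma rnorm0 : rnorm (0 : V) = 0.
Proof. by rewrite /rnorm normr0. Qed.

Lemma rnorm_eq0 x : (rnorm x == 0) = (x == 0).
Proof. by rewrite -(inj_eq (@complexI R)) -rnormE normr_eq0. Qed.

Lemma rnorm_gt0 x : (0 < rnorm x) = (x != 0).
Proof. by rewrite lt_def rnorm_ge0 andbT rnorm_eq0. Qed.

Lemma rnorm_sum n (f : nat -> V) : rnorm (\sum_(j < n) f j) <= \sum_(j < n) rnorm (f j).
Proof.
elim: n => [|n IH]; first by rewrite !big_ord0 rnorm0.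
by rewrite !big_ord_recr /=; apply: le_trans (rnormD _ _) _; rewrite lerD2r.
Qed.

Lemma rnormD_sq x y : rnorm (x + y) ^+ 2 <= 2 * rnorm x ^+ 2 + 2 * rnorm y ^+ 2.
Proof.
have h := rnormD x y; have h0 := rnorm_ge0 (x + y).
apply: (@le_trans _ _ ((rnorm x + rnorm y) ^+ 2)).
  by rewrite ler_pXn2r ?nnegrE ?addr_ge0 ?rnorm_ge0.
have := sqr_ge0 (rnorm x - rnorm y); nra.
Qed.

End RnormTheory.

Section DotTheory.
Context {R : realType} {V : completeNormedModType R[i]}.
Variable dot : {dot V for Num.conj}.
Hypothesis dotV : is_hilbert_dot dot.
Implicit Types (x y : V) (a : R[i]).

Lemma dotDl x y z : dot (x + y) z = dot x z + dot y z.
Proof. exact: linearDl. Qed.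

Lemma dotZl a x y : dot (a *: x) y = a * dot x y.
Proof. exact: linearZl_LR. Qed.

Lemma dotC x y : dot x y = (dot y x)^*.
Proof. by rewrite hermC expr0 mul1r. Qed.

Lemma dotDr x y z : dot z (x + y) = dot z x + dot z y.
Proof. exact: linearDr. Qed.

Lemma dotZr a x y : dot x (a *: y) = a^* * dot x y.
Proof. exact: linearZr_LR. Qed.

Lemma dotNl x y : dot (- x) y = - dot x y.
Proof. exact: linearNl. Qed.

Lemma dot_suml n (f : 'I_n -> V) y : dot (\sum_j f j) y = \sum_j dot (f j) y.
Proof. exact: linear_sumlz. Qed.

Lemma dot_sumr n (f : 'I_n -> V) y : dot y (\sum_j f j) = \sum_j dot y (f j).
Proof. exact: linear_sumr. Qed.

Lemma dot_rnorm x : dot x x = (rnorm x ^+ 2)%:C.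
Proof. by rewrite dotV rnormE rmorphXn. Qed.

Lemma rnorm_sqE x : rnorm x ^+ 2 = complex.Re (dot x x).
Proof. by rewrite dot_rnorm. Qed.

Lemma rnormD_sqE x y :
  rnorm (x + y) ^+ 2 = rnorm x ^+ 2 + 2 * complex.Re (dot x y) + rnorm y ^+ 2.
Proof.
rewrite !rnorm_sqE !dotDl !dotDr (dotC y x).
by case: (dot x x) (dot x y) (dot y y) => [a b] [c d] [e f] /=; ring.
Qed.

Lemma cauchy_schwarz x y : `|complex.Re (dot x y)| <= rnorm x * rnorm y.
Proof.
have nx := rnorm_ge0 x; have ny := rnorm_ge0 y.
have [y0|] := eqVneq (rnorm y) 0.
  by move/eqP: y0; rewrite rnorm_eq0 => /eqP ->; rewrite linear0r /= normr0 mulr_ge0 ?rnorm_ge0.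
move=> ny0; have {ny0}ny0 : 0 < rnorm y by rewrite lt_def ny0.
set r := complex.Re _.
rewrite -(@ler_pXn2r _ 2) ?nnegrE ?mulr_ge0// real_normK ?num_real//.
have := sqr_ge0 (rnorm (x + (- (r / rnorm y ^+ 2))%:C *: y)).
rewrite rnormD_sqE dotZr rnormZ normc_real exprMn real_normK ?num_real//.
have -> : complex.Re (((- (r / rnorm y ^+ 2))%:C)^* * dot x y) = - (r / rnorm y ^+ 2) * r.
  by rewrite /r; case: (dot x y) => a b /=; ring.
move=> h.
have h2 := mulr_ge0 h (sqr_ge0 (rnorm y)).
have -> : (rnorm x * rnorm y) ^+ 2 = r ^+ 2 + (rnorm x ^+ 2 + 2 * (- (r / rnorm y ^+ 2) * r) +
      (- (r / rnorm y ^+ 2)) ^+ 2 * rnorm y ^+ 2) * rnorm y ^+ 2.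
  by field; rewrite gt_eqF.
by rewrite lerDl.
Qed.

Definition dft_coef N (k j : nat) : R[i] :=
  expi (- (pi *+ 2 * k%:R * j%:R / N%:R)).

Lemma sum_expi_cycle N (d : R) : expi (N%:R * d) = 1 -> expi d != 1 ->
  \sum_(k < N) expi (k%:R * d) = 0.
Proof.
move=> eN e1.
have : (expi d - 1) * \sum_(k < N) expi (k%:R * d) = 0.
  under eq_bigr do rewrite -expiX.
  by rewrite -subrX1 expiX eN subrr.
by move/eqP; rewrite mulf_eq0 subr_eq0 (negbTE e1) /= => /eqP.
Qed.

(** Off the diagonal this is a full geometric sum of an [N]-th root of unity [expi d] different from
    1. When [l < j] the angle [d] is negative, and the argument goes through [- d]. *)
Lemma dft_ortho N (j l : 'I_N) :
  \sum_(k < N) dft_coef N k j * (dft_coef N k l)^* = (j == l)%:R * N%:R.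
Proof.
have N0 : (0 < N)%N by case: N j {l} => // -[].
have Nr : 0 < N%:R :> R by rewrite ltr0n.
pose d : R := pi *+ 2 * (l%:R - j%:R) / N%:R.
have E (k : 'I_N) : dft_coef N k j * (dft_coef N k l)^* = expi (k%:R * d).
  rewrite conj_expi -expiD; congr expi; rewrite /d; field; exact: lt0r_neq0.
under eq_bigr do rewrite E.
have [jl|jl] := eqVneq j l.
  rewrite /d jl subrr mulr0 mul0r.
  under eq_bigr do rewrite mulr0 expi0.
  by rewrite sumr_const card_ord mul1r.
rewrite mul0r; apply: sum_expi_cycle.
  have -> : N%:R * d = pi *+ 2 * l%:R - pi *+ 2 * j%:R.
    by rewrite /d; field; exact: lt0r_neq0.
  have e2 n : expi (pi *+ 2 * n%:R) = 1 :> R[i].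
    by rewrite mulrC -expiX /expi cos2pi sin2pi complexr0 expr1n.
  by rewrite expiD e2 mul1r -conj_expi e2 rmorph1.
have expiN1 (x : R) : expi (- x) != 1 -> expi x != 1.
  by apply: contra => /eqP e; rewrite -conj_expi e rmorph1.
have p0 := @pi_gt0 R.
have main (m n : 'I_N) : (m < n)%N -> 0 < (pi *+ 2 * (n%:R - m%:R) / N%:R : R) < pi *+ 2.
  move=> mn; have h1 : m%:R < n%:R :> R by rewrite ltr_nat.
  have h2 : n%:R < N%:R :> R by rewrite ltr_nat.
  have h3 : 0 <= m%:R :> R by [].
  have p2 : 0 < pi *+ 2 :> R by rewrite mulr2n; lra.
  rewrite divr_gt0 ?mulr_gt0 ?subr_gt0//= ltr_pdivrMr// ltr_pM2l//; lra.
case: (ltngtP j l) => [jl'|lj|/val_inj e]; last by rewrite e eqxx in jl.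
  by apply: expi_neq1; exact: main.
apply: expiN1; apply: expi_neq1.
suff -> : - d = pi *+ 2 * (j%:R - l%:R) / N%:R by exact: main.
by rewrite /d; field; exact: lt0r_neq0.
Qed.

Lemma parseval_dot N (x y : nat -> V) :
  \sum_(k < N) dot (\sum_(j < N) dft_coef N k j *: x j)
                   (\sum_(j < N) dft_coef N k j *: y j)
  = N%:R * \sum_(j < N) dot (x j) (y j).
Proof.
transitivity (\sum_(j < N) \sum_(l < N)
    (\sum_(k < N) dft_coef N k j * (dft_coef N k l)^*) * dot (x j) (y l)).
  transitivity (\sum_(k < N) \sum_(j < N) \sum_(l < N)
    (dft_coef N k j * (dft_coef N k l)^*) * dot (x j) (y l)).
    apply: eq_bigr => k _; rewrite dot_suml; apply: eq_bigr => j _.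
    by rewrite dotZl dot_sumr mulr_sumr; apply: eq_bigr => l _; rewrite dotZr mulrA.
  rewrite exchange_big; apply: eq_bigr => j _ /=.
  rewrite exchange_big; apply: eq_bigr => l _ /=.
  by rewrite big_distrl.
rewrite mulr_sumr; apply: eq_bigr => j _.
rewrite (bigD1 j) //= dft_ortho eqxx mul1r big1 ?addr0// => l lj.
by rewrite dft_ortho eq_sym (negbTE lj) !mul0r.
Qed.

Lemma parseval N (x : nat -> V) :
  \sum_(k < N) rnorm (\sum_(j < N) dft_coef N k j *: x j) ^+ 2
  = N%:R * \sum_(j < N) rnorm (x j) ^+ 2.
Proof.
have /(congr1 (@complex.Re R)) := parseval_dot N x x.
under eq_bigr do rewrite dot_rnorm.
under [in RHS]eq_bigr do rewrite dot_rnorm.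
by rewrite -!rmorph_sum /= -(rmorph_nat (real_complex R)) -rmorphM.
Qed.

End DotTheory.

(** * The group and its generator *)

Section System.
Context {R : realType} (S : obs_system R).
Local Notation X := (obs_X S).
Local Notation Y := (obs_Y S).
Local Notation D := (@obs_D _ S).
Local Notation A := (@obs_A _ S).
Local Notation U := (@obs_U _ S).
Local Notation C := (@obs_C _ S).
Local Notation dX := (obs_dotX S).
Implicit Types (x y z : X) (a : R[i]) (t h : R).

Lemma domZD a x y : D x -> D y -> D (a *: x + y).
Proof. by have [[_ H] _ _ _] := obs_self_adjoint S; exact: H. Qed.

Lemma dom0 : D 0.
Proof. by have [[H _] _ _ _] := obs_self_adjoint S. Qed.

Lemma domD x y : D x -> D y -> D (x + y).
Proof. by move=> Dx Dy; rewrite -[x]scale1r; exact: domZD. Qed.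

Lemma domZ a x : D x -> D (a *: x).
Proof. by move=> Dx; rewrite -[_ *: _]addr0; apply: domZD => //; exact: dom0. Qed.

Lemma domB x y : D x -> D y -> D (x - y).
Proof. by move=> Dx Dy; rewrite addrC -scaleN1r; exact: domZD. Qed.

Lemma dom_sum n (f : nat -> X) : (forall j, (j < n)%N -> D (f j)) -> D (\sum_(j < n) f j).
Proof.
elim: n => [|n IH] Df; first by rewrite big_ord0; exact: dom0.
rewrite big_ord_recr /=; apply: domD; last exact: Df.
by apply: IH => j jn; apply: Df; rewrite ltnS ltnW.
Qed.

Section LinearOnDomain.
Context {V : lmodType R[i]} (B : X -> V).
Hypothesis linB : linear_on D B.

Lemma lin_on0 : B 0 = 0.
Proof. 
have := linB 1 dom0 dom0; rewrite !scale1r addr0 => /eqP.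
by rewrite -subr_eq0 opprD addrA subrr add0r oppr_eq0 => /eqP.
Qed.

Lemma lin_onD x y : D x -> D y -> B (x + y) = B x + B y.
Proof. by move=> Dx Dy; have := linB 1 Dx Dy; rewrite !scale1r. Qed.

Lemma lin_onZ a x : D x -> B (a *: x) = a *: B x.
Proof. by move=> Dx; rewrite -[a *: x]addr0 linB ?lin_on0 ?addr0 //; exact: dom0. Qed.

Lemma lin_onB x y : D x -> D y -> B (x - y) = B x - B y.
Proof.
by move=> Dx Dy; have := linB (-1) Dy Dx; rewrite !scaleN1r ![- _ + _]addrC.
Qed.

Lemma lin_on_sum n (f : nat -> X) : (forall j, (j < n)%N -> D (f j)) ->
  B (\sum_(j < n) f j) = \sum_(j < n) B (f j).
Proof.
elim: n => [|n IH] Df; first by rewrite !big_ord0 lin_on0.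
have Df' j : (j < n)%N -> D (f j) by move=> jn; apply: Df; rewrite ltnS ltnW.
by rewrite !big_ord_recr /= lin_onD ?IH//; [exact: dom_sum|exact: Df].
Qed.

End LinearOnDomain.

Lemma A_lin : linear_on D A.
Proof. by have [_ H _ _] := obs_self_adjoint S. Qed.

Lemma C_lin : linear_on D C. Proof. exact: obs_C_linear. Qed.

Lemma lin_on_comp_linear (V : lmodType R[i]) (L : {linear X -> V}) : linear_on D L.
Proof. by move=> a x y _ _; rewrite linearP. Qed.

Lemma U0 x : U 0 x = x. Proof. by have [H _ _ _] := obs_group S. Qed.

Lemma U_add s t x : U (s + t) x = U s (U t x).
Proof. by have [_ H _ _] := obs_group S. Qed.

Lemma rnormU t x : rnorm (U t x) = rnorm x.
Proof. by have [_ _ H _] := obs_group S; rewrite /rnorm H. Qed.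

Lemma U_cont x (e : R) : 0 < e ->
  exists2 d : R, 0 < d & forall t, `|t| < d -> rnorm (U t x - x) < e.
Proof.
move=> e0; have [_ _ _ H] := obs_group S.
have /cvgrPdist_lt /(_ e%:C) := H x 0.
rewrite gtr0c => /(_ e0) /nbhs_normP [d /= d0 dH].
exists d => // t td; rewrite -rnormN opprB -ltcR -rnormE -{1}[x]U0.
by apply: dH; rewrite /= sub0r normrN.
Qed.

(** The factor [- 'i] makes the quotient approximate [A] itself instead of [iA]. *)
Definition diffq h x : X := (- 'i * (h^-1)%:C) *: (U h x - x).

Lemma imag_neq0 : 'i != 0 :> R[i]. Proof. exact: neq0Ci. Qed.

(** The difference quotient at [U t z] is the image under the isometry [U t] of the one at [z],
    hence it converges; the generator is characterized by this convergence. *)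
Lemma U_dom t z : D z -> D (U t z) /\ A (U t z) = U t (A z).
Proof.
move=> Dz; have G := @obs_generator _ S.
have /G H : D z /\ 'i *: A z = 'i *: A z by [].
suff : (fun h : R => (h^-1)%:C *: (U h (U t z) - U t z)) @ 0^' --> U t ('i *: A z).
  move/G => [Dt]; rewrite linearZ /= => /(congr1 (fun v => 'i^-1 *: v)).
  by rewrite !scalerA mulVf ?imag_neq0// !scale1r.
have -> : (fun h : R => (h^-1)%:C *: (U h (U t z) - U t z)) =
   (fun h : R => U t ((h^-1)%:C *: (U h z - z))).
  by apply/funext => h; rewrite linearZ [U t (_ - _)]linearB /= -!U_add (addrC h).
apply/cvgrPdist_lt => e e0; move/cvgrPdist_lt: H => /(_ e e0).
apply: filterS => h; apply: le_lt_trans.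
by rewrite -linearB !rnormE rnormU.
Qed.

Lemma diffq_cvg z (e : R) : D z -> 0 < e ->
  exists2 d : R, 0 < d & forall h, h != 0 -> `|h| < d -> rnorm (diffq h z - A z) < e.
Proof.
move=> Dz e0; have G := @obs_generator _ S.
have /G /cvgrPdist_lt /(_ e%:C) : D z /\ 'i *: A z = 'i *: A z by [].
rewrite gtr0c => /(_ e0) /nbhs_normP [d /= d0 dH].
exists d => // h h0 hd; rewrite -ltcR -rnormE.
have := dH h; rewrite /= sub0r normrN => /(_ hd h0); apply: le_lt_trans.
have -> : diffq h z - A z = 'i *: ('i *: A z - (h^-1)%:C *: (U h z - z)).
  rewrite /diffq [RHS]scalerBr !scalerA -expr2 sqrCi scaleN1r mulNr scaleNr.
  by rewrite [RHS]addrC.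
by rewrite !rnormE rnormZ imagE /= expr0n /= add0r expr1n sqrtr1 mul1r.
Qed.

Lemma dot_A_sym x y : D x -> D y -> dX (A x) y = dX x (A y).
Proof.
move=> Dx Dy; have [_ _ _ H] := obs_self_adjoint S.
by have [/(_ (conj Dy erefl)) H' _] := H y (A y); exact: H'.
Qed.

Lemma dot_A_real z : D z -> dX (A z) z = (complex.Re (dX (A z) z))%:C.
Proof.
move=> Dz; have := dot_A_sym Dz Dz; rewrite [RHS](dotC (dX)).
by case: (dX (A z) z) => a b [ab]; congr Complex; lra.
Qed.

(** Unlike the frequency, this quadratic form makes sense at 0 and adds up over the packets. *)
Definition energy z : R := complex.Re (dX (A z) z).

Lemma energy_ge0 z : D z -> 0 <= energy z.
Proof.
move=> Dz; have [m m0 H] := @obs_positive _ S; apply: le_trans (H _ Dz).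
exact: mulr_ge0 (ltW m0) (sqr_ge0 _).
Qed.

Lemma normsq_A_shift z (s : R[i]) : D z ->
  rnorm (A z - s *: z) ^+ 2 =
  rnorm (A z) ^+ 2 - 2 * complex.Re s * energy z + Normc.normc s ^+ 2 * rnorm z ^+ 2.
Proof.
move=> Dz; rewrite -scaleNr (rnormD_sqE (@obs_hilbertX _ S)).
rewrite dotZr dot_A_real // rnormZ exprMn normcN.
by rewrite /energy; case: s => a b /=; ring.
Qed.

Lemma frequencyE z : z != 0 -> energy z = frequency z * rnorm z ^+ 2.
Proof.
by move=> z0; rewrite /frequency divfK// expf_neq0// rnorm_eq0.
Qed.

Lemma frequency_ge0 z : D z -> 0 <= frequency z.
Proof. by move=> Dz; rewrite divr_ge0 ?energy_ge0// exprn_ge0// rnorm_ge0. Qed.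

(* The shift [s] may be complex because [A] is symmetric. *)
Lemma variance_le z (s : R[i]) : D z -> z != 0 ->
  (rnorm (A z) ^+ 2 / rnorm z ^+ 2 - frequency z ^+ 2) * rnorm z ^+ 2
    <= rnorm (A z - s *: z) ^+ 2.
Proof.
move=> Dz z0; rewrite normsq_A_shift// frequencyE// normc_sq.
rewrite mulrBl [_ (A z) ^+ 2 / _ * _]divfK ?expf_neq0 ?rnorm_eq0//.
have := mulr_ge0 (sqr_ge0 (complex.Re s - frequency z)) (sqr_ge0 (rnorm z)).
have := mulr_ge0 (sqr_ge0 (complex.Im s)) (sqr_ge0 (rnorm z)); nra.
Qed.

(** The frequency is the shift for which [variance_le] is an equality. *)
Lemma varianceE z : D z -> z != 0 ->
  rnorm (A z - (frequency z)%:C *: z) ^+ 2 =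
  (rnorm (A z) ^+ 2 / rnorm z ^+ 2 - frequency z ^+ 2) * rnorm z ^+ 2.
Proof.
move=> Dz z0; rewrite normsq_A_shift// frequencyE// normc_sq /=.
rewrite mulrBl [_ (A z) ^+ 2 / _ * _]divfK ?expf_neq0 ?rnorm_eq0//.
move: (rnorm _) (rnorm z) (frequency z) => a b c; ring.
Qed.

Lemma variance_ge0 z : D z -> z != 0 ->
  0 <= rnorm (A z) ^+ 2 / rnorm z ^+ 2 - frequency z ^+ 2.
Proof.
move=> Dz z0; have := sqr_ge0 (rnorm (A z - (frequency z)%:C *: z)).
by rewrite varianceE// pmulr_lge0// exprn_gt0// rnorm_gt0.
Qed.

End System.

(** * Discrete wave packets *)

Section Window.
Context {R : realType}.
Implicit Types (N j : nat).

(* It vanishes at [j = 0] and [j = N]: the cyclic shift of a windowed orbit has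
   no boundary term. *)
Definition window N j : R := j%:R * (N%:R - j%:R).

Definition window_mass N : R := \sum_(j < N) window N j ^+ 2.

Lemma window_massE N : window_mass N = (N%:R ^+ 5 - N%:R) / 30.
Proof.
(* The induction runs over partial sums, with [N] kept fixed inside the window. *)
have H n : \sum_(j < n) window N j ^+ 2 =
    N%:R ^+ 2 * (n%:R * (n%:R - 1) * (2 * n%:R - 1) / 6)
    - 2 * N%:R * (n%:R * (n%:R - 1) / 2) ^+ 2
    + n%:R * (n%:R - 1) * (2 * n%:R - 1) * (3 * n%:R ^+ 2 - 3 * n%:R - 1) / 30.
  elim: n => [|n IH]; first by rewrite big_ord0; field.
  by rewrite big_ord_recr /= IH /window -natr1; field.
by rewrite /window_mass H; field.
Qed.

Lemma window_mass_ge N : (1 < N)%N -> N%:R ^+ 5 / 60 <= window_mass N.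
Proof.
move=> N1; rewrite window_massE; have N2 : 2 <= N%:R :> R by rewrite ler_nat.
have N0 : 0 <= N%:R :> R by lra.
have : 2 ^+ 4 <= N%:R ^+ 4 :> R by rewrite lerXn2r ?nnegrE.
move=> h; have := ler_wpM2r N0 h; lra.
Qed.

Lemma window_sq_le N j : (j <= N)%N -> window N j ^+ 2 <= N%:R ^+ 4 / 16.
Proof.
move=> jN; have jN' : j%:R <= N%:R :> R by rewrite ler_nat.
have j0 : 0 <= j%:R :> R by [].
have -> : N%:R ^+ 4 / 16 = (N%:R ^+ 2 / 4) ^+ 2 :> R by field.
rewrite lerXn2r ?nnegrE//; first by rewrite mulr_ge0 ?subr_ge0.
rewrite /window; have := sqr_ge0 (N%:R - 2 * j%:R : R); nra.
Qed.

Lemma window_step_le N j : (j < N)%N -> (window N j - window N j.+1) ^+ 2 <= N%:R ^+ 2.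
Proof.
move=> jN; have jN' : j.+1%:R <= N%:R :> R by rewrite ler_nat.
have j0 : 0 <= j%:R :> R by [].
rewrite /window -natr1 in jN' *.
rewrite -real_normK ?num_real// lerXn2r ?nnegrE//; rewrite ler_norml; apply/andP; split; nra.
Qed.

Definition window_weight N j : R := window N j ^+ 2 / window_mass N.

Lemma window_mass_gt0 N : (1 < N)%N -> 0 < window_mass N.
Proof.
move=> N1; apply: lt_le_trans (window_mass_ge N1).
by rewrite divr_gt0// exprn_gt0// ltr0n ltnW.
Qed.

Lemma sum_window_weight N : (1 < N)%N -> \sum_(j < N) window_weight N j = 1.
Proof.
by move=> N1; rewrite -mulr_suml divff// gt_eqF// window_mass_gt0.
Qed.

Lemma window_weight_le N j : (1 < N)%N -> (j <= N)%N -> window_weight N j <= 4 / N%:R.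
Proof.
move=> N1 jN; have N0 : 0 < N%:R :> R by rewrite ltr0n ltnW.
rewrite ler_pdivrMr ?window_mass_gt0//; apply: le_trans (window_sq_le jN) _.
have h : 0 <= 4 / N%:R :> R by rewrite divr_ge0.
apply: le_trans (ler_wpM2l h (window_mass_ge N1)).
have -> : 4 / N%:R * (N%:R ^+ 5 / 60) = N%:R ^+ 4 / 15 :> R by field; rewrite gt_eqF.
have := exprn_ge0 4 (ltW N0); lra.
Qed.

End Window.

Section Packets.
Context {R : realType} (S : obs_system R).
Local Notation X := (obs_X S).
Local Notation D := (@obs_D _ S).
Local Notation A := (@obs_A _ S).
Local Notation U := (@obs_U _ S).
Local Notation dX := (obs_dotX S).
Variables (z : X) (h : R) (N : nat).
Hypotheses (Dz : D z) (N1 : (1 < N)%N).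

(** Normalization for which the weights left by Parseval sum to 1. *)
Let c : R := (Num.sqrt (N%:R * window_mass N))^-1.

Let cE j : N%:R * (c * window N j) ^+ 2 = window_weight N j.
Proof.
have m0 := @window_mass_gt0 R _ N1.
have N0 : 0 < N%:R :> R by rewrite ltr0n ltnW.
rewrite exprMn exprVn sqr_sqrtr ?mulr_ge0 ?ltW//.
by rewrite /window_weight; field; rewrite !gt_eqF.
Qed.

Let sample j : X := (c * window N j)%:C *: U (j%:R * h) z.

Definition phase k : R := pi *+ 2 * k%:R / N%:R.

Lemma phase_ge0_lt k : (k < N)%N -> 0 <= phase k < pi *+ 2.
Proof.
move=> kN; have p0 := @pi_gt0 R; have N0 : 0 < N%:R :> R by rewrite ltr0n ltnW.
have p2 : 0 < pi *+ 2 :> R by rewrite mulr2n; lra.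
rewrite /phase divr_ge0 ?mulr_ge0 ?(ltW p2)//=.
by rewrite ltr_pdivrMr// ltr_pM2l// ltr_nat.
Qed.

(* The discrete Fourier transform of the windowed orbit of [z] plays the role
   of its spectral decomposition. *)
Definition packet k : X := \sum_(j < N) dft_coef N k j *: sample j.

Let Dsample j : D (sample j).
Proof. by apply: domZ; exact: (U_dom _ Dz).1. Qed.

Lemma packet_dom k : D (packet k).
Proof. by apply: (@dom_sum _ S N (fun j => dft_coef N k j *: sample j)) => j _; apply: domZ. Qed.

Let lin_packet (V : lmodType R[i]) (B : X -> V) k : linear_on D B ->
  B (packet k) = \sum_(j < N) dft_coef N k j *: B (sample j).
Proof.
move=> linB; rewrite (lin_on_sum linB (f := fun j => dft_coef N k j *: sample j)).
  by apply: eq_bigr => j _; rewrite (lin_onZ linB).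
by move=> j _; apply: domZ.
Qed.

Lemma packet_sum (V : completeNormedModType R[i]) (dV : {dot V for Num.conj}) (B : X -> V) :
  is_hilbert_dot dV -> linear_on D B ->
  \sum_(k < N) rnorm (B (packet k)) ^+ 2
    = \sum_(j < N) window_weight N j * rnorm (B (U (j%:R * h) z)) ^+ 2.
Proof.
move=> hV linB.
have E k : B (packet k) = \sum_(j < N) dft_coef N k j *:
    ((c * window N j)%:C *: B (U (j%:R * h) z)).
  rewrite lin_packet//; apply: eq_bigr => j _; rewrite (lin_onZ linB)//.
  exact: (U_dom _ Dz).1.
under eq_bigr do rewrite E.
rewrite (parseval hV N (fun j => (c * window N j)%:C *: B (U (j%:R * h) z))).
rewrite mulr_sumr; apply: eq_bigr => j _.
by rewrite rnormZ normc_real exprMn real_normK ?num_real// mulrA cE.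
Qed.

Lemma packet_norm : \sum_(k < N) rnorm (packet k) ^+ 2 = rnorm z ^+ 2.
Proof.
rewrite (packet_sum (@obs_hilbertX _ S) (lin_on_comp_linear (idfun : {linear X -> X}))) /=.
under eq_bigr do rewrite rnormU.
by rewrite -mulr_suml sum_window_weight// mul1r.
Qed.

Lemma Re_dotU t x y : complex.Re (dX (U t x) (U t y)) = complex.Re (dX x y).
Proof.
have e1 := rnormD_sqE (@obs_hilbertX _ S) x y.
have e2 := rnormD_sqE (@obs_hilbertX _ S) (U t x) (U t y).
rewrite -linearD !rnormU in e2; lra.
Qed.

(** [U] commutes with [A] and preserves real parts of scalar products, so all points of the orbit
    have the energy of [z]; Parseval leaves a weighted mean of this constant. *)
Lemma packet_energy : \sum_(k < N) energy (packet k) = energy z.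
Proof.
have E k := lin_packet k (@A_lin _ S).
have /(congr1 (@complex.Re R)) := parseval_dot dX N (fun j => A (sample j)) sample.
rewrite !raddf_sum /= /energy; under eq_bigr do rewrite -E.
move=> ->.
have -> : \sum_(j < N) dX (A (sample j)) (sample j) =
   (\sum_(j < N) (c * window N j) ^+ 2 * energy z)%:C.
  rewrite rmorph_sum /=; apply: eq_bigr => j _.
  rewrite dot_A_real//; congr (_%:C).
  have Du := (U_dom (j%:R * h) Dz).1.
  rewrite (lin_onZ (@A_lin _ S))// dotZl dotZr (U_dom _ Dz).2.
  rewrite /energy -(Re_dotU (j%:R * h)).
  by case: (dX _ _) => a b /=; ring.
rewrite -(rmorph_nat (real_complex R)) -rmorphM /= -mulr_suml mulrA mulr_sumr.
by under eq_bigr do rewrite cE; rewrite sum_window_weight// mul1r.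
Qed.

(** Summation by parts: [U h] advances the samples by one index and the phase undoes this in the
    transform, so only increments of the window remain. They are at most [N], against a mass of
    order [N ^+ 5]. *)
Lemma packet_shift :
  \sum_(k < N) rnorm (U h (packet k) - expi (phase k) *: packet k) ^+ 2
    <= 60 / N%:R ^+ 2 * rnorm z ^+ 2.
Proof.
have N0 : 0 < N%:R :> R by rewrite ltr0n ltnW.
have E k : U h (packet k) - expi (phase k) *: packet k =
  \sum_(j < N) dft_coef N k j *:
    ((c * (window N j - window N j.+1))%:C *: U (j.+1%:R * h) z).
  pose f j := (expi (phase k) * dft_coef N k j) *: sample j.
  have f0 : \sum_(j < N) (f j.+1 - f j) = 0.
    rewrite -(big_mkord predT (fun j => f j.+1 - f j)) telescope_sumr//.
    rewrite /f /sample /window subrr mulr0n !mulr0 mul0r mulr0 !scale0r.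
    by rewrite !scaler0 subrr.
  transitivity (U h (packet k) - expi (phase k) *: packet k - \sum_(j < N) (f j.+1 - f j)).
    by rewrite f0 subr0.
  rewrite /packet linear_sum scaler_sumr -!sumrB; apply: eq_bigr => j _.
  rewrite /f /sample.
  have -> : expi (phase k) * dft_coef N k j.+1 = dft_coef N k j.
    rewrite /dft_coef -expiD; congr expi; rewrite /phase -natr1; field.
    by rewrite gt_eqF.
  rewrite [U h _]linearZ [U h _]linearZ /= -U_add [h + _]addrC.
  have -> : j%:R * h + h = j.+1%:R * h by rewrite -natr1 mulrDl mul1r.
  rewrite !scalerA opprB addrA subrK -scalerBl -mulrBr -rmorphB /=.
  by rewrite -mulrBr.
under eq_bigr do rewrite E.
rewrite (parseval (@obs_hilbertX _ S) N
  (fun j => (c * (window N j - window N j.+1))%:C *: U (j.+1%:R * h) z)).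
have m0 := @window_mass_gt0 R _ N1.
have cN : c ^+ 2 = (N%:R * window_mass N)^-1.
  by rewrite exprVn sqr_sqrtr// mulr_ge0 ?ltW.
apply: (@le_trans _ _ (N%:R * \sum_(j < N) (c ^+ 2 * N%:R ^+ 2 * rnorm z ^+ 2))).
  rewrite ler_wpM2l ?ler0n//; apply: ler_sum => j _.
  rewrite rnormZ rnormU normc_real exprMn real_normK ?num_real//.
  by rewrite ler_wpM2r ?sqr_ge0// exprMn ler_wpM2l ?sqr_ge0// window_step_le.
rewrite sumr_const card_ord -[(_ * rnorm z ^+ 2) *+ N]mulr_natr cN.
have -> : N%:R * ((N%:R * window_mass N)^-1 * N%:R ^+ 2 * rnorm z ^+ 2 * N%:R)
   = N%:R ^+ 3 / window_mass N * rnorm z ^+ 2 by field; rewrite !gt_eqF.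
rewrite ler_wpM2r ?sqr_ge0// ler_pdivrMr//.
have h60 : 0 <= 60 / N%:R ^+ 2 :> R by rewrite divr_ge0 ?sqr_ge0.
apply: le_trans (ler_wpM2l h60 (window_mass_ge N1)).
by rewrite le_eqVlt; apply/orP; left; apply/eqP; field; rewrite gt_eqF.
Qed.

(** The value taken by [diffq h] on a vector that [U h] multiplies by [expi (phase k)]. *)
Definition packet_freq k : R[i] := (- 'i * (h^-1)%:C) * (expi (phase k) - 1).

(** Compare [A] with [diffq h]. On packets [diffq h] misses the scalar by the shift error divided by
    [h]; the defect [diffq h - A] commutes with the group, so by Parseval its squares sum to its
    value at [z]. *)
Lemma packet_residual : h != 0 ->
  \sum_(k < N) rnorm (A (packet k) - packet_freq k *: packet k) ^+ 2
    <= 120 / (N%:R * h) ^+ 2 * rnorm z ^+ 2 + 2 * rnorm (diffq h z - A z) ^+ 2.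
Proof.
move=> h0.
have N0 : 0 < N%:R :> R by rewrite ltr0n ltnW.
pose B x := diffq h x - A x.
have linB : linear_on D B.
  move=> a x y Dx Dy; rewrite /B /diffq (A_lin a Dx Dy) linearP.
  have -> : a *: U h x + U h y - (a *: x + y) = a *: (U h x - x) + (U h y - y).
    by rewrite [a *: (_ - x)]scalerBr opprD addrACA.
  move: (- 'i * _) => g; by rewrite scalerDr scalerA mulrC -scalerA [a *: (_ - A x)]scalerBr opprD addrACA.
have E k : A (packet k) - packet_freq k *: packet k =
  (- 'i * (h^-1)%:C) *: (U h (packet k) - expi (phase k) *: packet k) - B (packet k).
  rewrite /B /diffq /packet_freq; move: (- 'i * _) => g.
  rewrite -scalerA [(_ - 1) *: _]scalerBl scale1r opprB addrCA; congr (_ + _).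
  by rewrite -scalerBr -scalerN !opprB [in RHS]addrC addrA subrK.
have nrm : Normc.normc (- 'i * (h^-1)%:C) ^+ 2 = (h ^+ 2)^-1 :> R.
  by rewrite normc_sq imagE /=; field.
have step k : rnorm (A (packet k) - packet_freq k *: packet k) ^+ 2 <=
  2 * ((h ^+ 2)^-1 * rnorm (U h (packet k) - expi (phase k) *: packet k) ^+ 2) +
  2 * rnorm (B (packet k)) ^+ 2.
  by rewrite E; apply: le_trans (rnormD_sq _ _) _; rewrite rnormN rnormZ exprMn nrm.
apply: (le_trans (ler_sum _ (fun (k : 'I_N) _ => step k))).
rewrite big_split /= -!mulr_sumr (packet_sum (@obs_hilbertX _ S) linB).
have -> : \sum_(j < N) window_weight N j * rnorm (B (U (j%:R * h) z)) ^+ 2 =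
    rnorm (B z) ^+ 2.
  transitivity (\sum_(j < N) window_weight N j * rnorm (B z) ^+ 2); last first.
    by rewrite -mulr_suml sum_window_weight// mul1r.
  apply: eq_bigr => j _; congr (_ * _ ^+ 2).
  rewrite -[RHS](rnormU (j%:R * h)) /B /diffq [U _ (_ - A z)]linearB.
  rewrite [U _ (_ *: _)]linearZ /= [U _ (U h z - z)]linearB (U_dom _ Dz).2.
  by rewrite -!U_add (addrC h).
rewrite lerD2r.
apply: (@le_trans _ _ (2 * ((h ^+ 2)^-1 * (60 / N%:R ^+ 2 * rnorm z ^+ 2)))).
  by rewrite ler_wpM2l// ler_wpM2l ?invr_ge0 ?sqr_ge0// packet_shift.
by rewrite le_eqVlt; apply/orP; left; apply/eqP; field; rewrite h0 gt_eqF.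
Qed.

End Packets.

(** * Riemann sums of the output *)

Section RiemannSums.
Context {R : realType}.
Notation mu := (@lebesgue_measure R).
Variable g : R -> R.
Hypothesis g_cont : continuous g.

Let g_int a b : mu.-integrable `[a, b] (EFin \o g).
Proof.
apply: continuous_compact_integrable; first exact: segment_compact.
exact: continuous_subspaceT.
Qed.

Let int_oc_bounds (a b lo hi : R) : a <= b ->
  (forall t, a <= t <= b -> lo <= g t <= hi) ->
  (b - a) * lo <= \int[mu]_(t in `]a, b]) g t <= (b - a) * hi.
Proof.
move=> ab H.
have mab : measurable `]a, b] by exact: measurable_itv.
have sub : (`]a, b] `<=` `[a, b])%classic.
  by move=> x /=; rewrite !in_itv /= => /andP[/ltW -> ->].
have ig : mu.-integrable `]a, b] (EFin \o g) by exact: integrableS (g_int a b).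
have ic r : mu.-integrable `]a, b] (EFin \o (fun=> r)).
  apply: (@integrableS _ _ _ mu `[a, b]) => //.
  apply: continuous_compact_integrable; first exact: segment_compact.
  by apply: continuous_subspaceT => x; exact: cvg_cst.
have Ec r : \int[mu]_(t in `]a, b]) r = (b - a) * r.
  rewrite Rintegral_cst// mulrC; congr (_ * _).
  transitivity (fine (if (a%:E < b%:E)%E then b%:E - a%:E else 0)%E).
    by congr fine; exact: lebesgue_measure_itv.
  rewrite lte_fin; case: ltP => [_|ba] //=.
  have -> : b = a by apply/eqP; rewrite eq_le ab ba.
  by rewrite subrr.
rewrite -!Ec; apply/andP; split; apply: le_Rintegral => // x /=;
  by rewrite in_itv /= => /andP[/ltW ax xb]; have := H x; rewrite ax xb => /(_ isT)/andP[].
Qed.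

Lemma riemann_sum_error (h d : R) (n : nat) : 0 <= h ->
  (forall s t, `|s - t| <= h -> `|g s - g t| <= d) ->
  `|\int[mu]_(t in `[0, n%:R * h]) g t - h * \sum_(j < n) g (j%:R * h)|
    <= n%:R * h * d.
Proof.
move=> h0 H; elim: n => [|n IH].
  by rewrite big_ord0 !mul0r mulr0 set_itv1 Rintegral_set1 subr0 normr0.
rewrite big_ord_recr /=.
have nh : 0 <= n%:R * h by rewrite mulr_ge0.
have nnh : n%:R * h <= n.+1%:R * h by rewrite ler_wpM2r// ler_nat.
have /esym E := @Rintegral_itvB R g (BLeft 0) (BRight (n.+1%:R * h)) (n%:R * h)
   (g_int _ _) ltac:(by rewrite bnd_simp) ltac:(by rewrite bnd_simp).
have hE : n.+1%:R * h - n%:R * h = h by rewrite -natr1; ring.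
have := @int_oc_bounds (n%:R * h) (n.+1%:R * h) (g (n%:R * h) - d) (g (n%:R * h) + d) nnh.
rewrite E hE => B.
have {}B : `|\int[mu]_(t in `[0, n.+1%:R * h]) g t - \int[mu]_(t in `[0, n%:R * h]) g t
   - h * g (n%:R * h)| <= h * d.
  have {B}/andP[B1 B2] : h * (g (n%:R * h) - d) <=
    \int[mu]_(t in `[0, n.+1%:R * h]) g t - \int[mu]_(t in `[0, n%:R * h]) g t
     <= h * (g (n%:R * h) + d).
    apply: B => t /andP[t1 t2].
    have : `|g t - g (n%:R * h)| <= d.
      by apply: H; rewrite ger0_norm ?subr_ge0//; lra.
    by rewrite ler_norml => /andP[h1 h2]; apply/andP; split; lra.
  by rewrite ler_norml; apply/andP; split; lra.
move: IH B; rewrite !ler_norml => /andP[I1 I2] /andP[B1 B2].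
by rewrite -natr1 in B1 B2 *; apply/andP; split; nra.
Qed.

End RiemannSums.

Section OutputEnergy.
Context {R : realType} (S : obs_system R).
Local Notation X := (obs_X S).
Local Notation D := (@obs_D _ S).
Local Notation A := (@obs_A _ S).
Local Notation U := (@obs_U _ S).
Local Notation C := (@obs_C _ S).
Implicit Types (z : X) (T h : R).

Definition output_sq z (t : R) : R := rnorm (C (U t z)) ^+ 2.

Definition out_energy T z : R := \int[lebesgue_measure]_(t in `[0, T]) output_sq z t.

Lemma output_sq_ge0 z t : 0 <= output_sq z t. Proof. exact: sqr_ge0. Qed.

(** [C] is bounded relative to [A], which commutes with the isometries [U t]: the output varies no
    faster than the orbit of [A z], uniformly on the whole line. *)
Lemma rnorm_CU_bound : exists2 K : R, 0 <= K & forall z, D z -> forall s t,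
  rnorm (C (U s z)) <= K * rnorm (A z) /\
  rnorm (C (U s z) - C (U t z)) <= K * rnorm (U (s - t) (A z) - A z).
Proof.
have [K HK] := @obs_C_bounded _ S; exists `|K| => // z Dz s t.
have H w : D w -> rnorm (C w) <= `|K| * rnorm (A w).
  by move=> Dw; apply: le_trans (HK _ Dw) _; rewrite ler_wpM2r ?rnorm_ge0// ler_norm.
have Ds := U_dom s Dz; have Dt := U_dom t Dz; split.
  by have := H _ Ds.1; rewrite Ds.2 rnormU.
rewrite -(lin_onB (@C_lin _ S) Ds.1 Dt.1).
apply: le_trans (H _ (domB Ds.1 Dt.1)) _.
rewrite (lin_onB (@A_lin _ S) Ds.1 Dt.1) Ds.2 Dt.2.
by rewrite -[X in _ <= _ * X](rnormU t) linearB -U_add (addrC t) subrK.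
Qed.

Lemma output_sq_unif z (e : R) : D z -> 0 < e ->
  exists2 d : R, 0 < d & forall s t, `|s - t| <= d -> `|output_sq z s - output_sq z t| <= e.
Proof.
move=> Dz e0; have [K K0 HK] := rnorm_CU_bound.
pose M := K * rnorm (A z).
have M0 : 0 <= M by rewrite mulr_ge0 ?rnorm_ge0.
have KM0 : 0 <= 2 * M * K by apply: mulr_ge0 => //; exact: mulr_ge0.
have q0 : 0 < e / (2 * M * K + 1) by rewrite divr_gt0// ltr_wpDl.
have [d d0 Hd] := U_cont (A z) q0.
exists (d / 2); first by rewrite divr_gt0.
move=> s t st; have /Hd/ltW h1 : `|s - t| < d by lra.
have [b1 b2] := HK _ Dz s t; have [b3 _] := HK _ Dz t t.
rewrite -/M in b1 b3.
rewrite /output_sq.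
set a := C (U s z) in b1 b2 *; set b := C (U t z) in b2 b3 *.
have ab : `|rnorm a - rnorm b| <= rnorm (a - b).
  have := rnormD (a - b) b; have := rnormD (b - a) a.
  rewrite !subrK -(rnormN (b - a)) opprB ler_norml => n1 n2.
  by apply/andP; split; lra.
have -> : rnorm a ^+ 2 - rnorm b ^+ 2 = (rnorm a - rnorm b) * (rnorm a + rnorm b) by ring.
have na := rnorm_ge0 a; have nb := rnorm_ge0 b.
rewrite normrM [`|rnorm a + rnorm b|]ger0_norm ?addr_ge0//.
apply: (@le_trans _ _ (K * (e / (2 * M * K + 1)) * (2 * M))).
  apply: ler_pM; rewrite ?addr_ge0//; last by lra.
  apply: le_trans ab _; apply: le_trans b2 _.
  by rewrite ler_wpM2l.
have -> : K * (e / (2 * M * K + 1)) * (2 * M) = e * ((2 * M * K) / (2 * M * K + 1)) by ring.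
rewrite ger_pMr// ler_pdivrMr ?ltr_wpDl//; lra.
Qed.

Lemma output_sq_cont z : D z -> continuous (output_sq z).
Proof.
move=> Dz t; apply/cvgrPdist_le => e e0.
have [d d0 H] := output_sq_unif Dz e0.
near=> s; apply: H; near: s.
by apply/nbhs_normP; exists d => //= s /= /ltW.
Unshelve. all: by end_near. Qed.

Lemma output_energyE T z : D z -> output_energy U C T z = (out_energy T z)%:E.
Proof.
move=> Dz; rewrite /output_energy /out_energy /Rintegral fineK//.
apply: integrable_fin_num => //.
apply: (@continuous_compact_integrable _ (output_sq z)); first exact: segment_compact.
by apply: continuous_subspaceT; exact: output_sq_cont.
Qed.

Definition riemann_output z h n : R := h * \sum_(j < n) output_sq z (j%:R * h).

Lemma riemann_output_cvg z T (e : R) : D z -> 0 < T -> 0 < e -> exists N0 : nat,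
  forall N, (N0 <= N)%N -> (0 < N)%N /\
    `|out_energy T z - riemann_output z (T / N%:R) N| <= e.
Proof.
move=> Dz T0 e0; have [d d0 H] := output_sq_unif Dz (divr_gt0 e0 T0).
pose N0 := (Num.trunc (T / d)).+1; exists N0 => N NN0.
have N1 : (0 < N)%N by apply: leq_trans NN0.
have Nr : 0 < N%:R :> R by rewrite ltr0n.
split=> //; have TN : T / N%:R <= d.
  rewrite ler_pdivrMr// -ler_pdivrMl// mulrC; apply: le_trans (ltW (truncnS_gt _)) _.
  by rewrite ler_nat.
have := @riemann_sum_error _ _ (output_sq_cont Dz) (T / N%:R) (e / T) N
  (divr_ge0 (ltW T0) (ltW Nr)).
have -> : N%:R * (T / N%:R) = T by field; rewrite gt_eqF.
have -> : T * (e / T) = e by field; rewrite gt_eqF.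
by apply=> s t st; apply: H; exact: le_trans TN.
Qed.

Lemma out_energy_ge0 T z : 0 <= out_energy T z.
Proof. by apply: Rintegral_ge0 => x _; exact: output_sq_ge0. Qed.

Lemma admissible T : 0 < T -> exists2 CT : R, 0 < CT &
  forall z, D z -> out_energy T z <= CT * rnorm z ^+ 2.
Proof.
move=> T0; have [CT CT0 H] := @obs_admissible _ S _ T0; exists CT => // z Dz.
by have := H z Dz; rewrite output_energyE// lee_fin.
Qed.

End OutputEnergy.

(** * From coercivity to observability *)

Section MainInequality.
Context {R : realType} (S : obs_system R).
Local Notation X := (obs_X S).
Local Notation D := (@obs_D _ S).
Local Notation A := (@obs_A _ S).
Local Notation U := (@obs_U _ S).
Local Notation C := (@obs_C _ S).
Implicit Types (z x : X).

(** Coercivity with both moduli frozen at one frequency level. *)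
Definition coercive_below (L e p : R) : Prop :=
  forall x, D x -> x != 0 -> frequency x <= L ->
    rnorm (A x) ^+ 2 / rnorm x ^+ 2 - frequency x ^+ 2 < e ->
    p * rnorm x ^+ 2 <= rnorm (C x) ^+ 2.

(** Each way of escaping coercivity is paid by one term: a high frequency by the energy, a large
    variance by the residual through [variance_le]. The bound is unconditional and quadratic, so it
    can be summed over packets. *)
Lemma coercive_split (L e p : R) x (s : R[i]) :
  0 < L -> 0 < e -> 0 < p -> coercive_below L e p -> D x ->
  rnorm x ^+ 2 <= p^-1 * rnorm (C x) ^+ 2 + L^-1 * energy x
    + e^-1 * rnorm (A x - s *: x) ^+ 2.
Proof.
move=> L0 e0 p0 H Dx.
have t1 : 0 <= p^-1 * rnorm (C x) ^+ 2 by rewrite mulr_ge0 ?sqr_ge0 ?invr_ge0 ?ltW.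
have t2 : 0 <= L^-1 * energy x by rewrite mulr_ge0 ?energy_ge0 ?invr_ge0 ?ltW.
have t3 : 0 <= e^-1 * rnorm (A x - s *: x) ^+ 2.
  by rewrite mulr_ge0 ?sqr_ge0 ?invr_ge0 ?ltW.
have [x0|x0] := eqVneq x 0.
  have : rnorm x ^+ 2 = 0 by rewrite x0 rnorm0 expr0n.
  lra.
have [fL|Lf] := lerP (frequency x) L; last first.
  have : rnorm x ^+ 2 <= L^-1 * energy x.
    by rewrite frequencyE// ler_pdivlMl// ler_wpM2r ?sqr_ge0// ltW.
  lra.
have [Ve|eV] := ltrP (rnorm (A x) ^+ 2 / rnorm x ^+ 2 - frequency x ^+ 2) e.
  have : rnorm x ^+ 2 <= p^-1 * rnorm (C x) ^+ 2.
    by rewrite ler_pdivlMl//; exact: H.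
  lra.
have : rnorm x ^+ 2 <= e^-1 * rnorm (A x - s *: x) ^+ 2.
  rewrite ler_pdivlMl//; apply: le_trans (variance_le s Dx x0).
  by rewrite ler_wpM2r ?sqr_ge0.
lra.
Qed.

(** In the sum of [coercive_split] over the packets, the energy costs at most 1/4 of the squared
    norm because [4 * frequency z <= L], the packet shift 1/4 because [120 / (T ^+ 2 * e) <= 1 / 4],
    and the difference quotient 1/8. The output carries the remaining 3/8. *)
Lemma coercive_below_observable (L e p T : R) z :
  0 < L -> 0 < e -> 0 < p -> 0 < T -> coercive_below L e p ->
  D z -> z != 0 -> 4 * frequency z <= L -> 480 <= T ^+ 2 * e ->
  p * T / 16 * rnorm z ^+ 2 <= out_energy T z.
Proof.
move=> L0 e0 p0 T0 H Dz z0 fL Te.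
have nz : 0 < rnorm z by rewrite rnorm_gt0.
apply/ler_addgt0Pr => eta eta0.
have r0 : 0 < Num.sqrt e * rnorm z / 4 by rewrite divr_gt0// mulr_gt0// sqrtr_gt0.
have [d d0 Hd] := diffq_cvg Dz r0.
have [N0 HN] := riemann_output_cvg Dz T0 eta0.
pose N := (maxn N0 (maxn 2 (Num.trunc (T / d)).+1)).
have N1 : (1 < N)%N by rewrite /N !leq_max orbT.
have [_ HR] := HN N (leq_maxl _ _).
have Nr : 0 < N%:R :> R by rewrite ltr0n ltnW.
pose h := T / N%:R.
have h0 : 0 < h by rewrite divr_gt0.
have hd : `|h| < d.
  rewrite gtr0_norm// ltr_pdivrMr// -ltr_pdivrMl// mulrC.
  apply: lt_le_trans (truncnS_gt _) _; rewrite ler_nat /N.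
  by rewrite !leq_max leqnn !orbT.
have hn0 : h != 0 by rewrite gt_eqF.
have rho : rnorm (diffq h z - A z) ^+ 2 <= e * rnorm z ^+ 2 / 16.
  have : rnorm (diffq h z - A z) ^+ 2 <= (Num.sqrt e * rnorm z / 4) ^+ 2.
    by rewrite lerXn2r ?nnegrE ?rnorm_ge0// ltW// Hd.
  have -> : (Num.sqrt e * rnorm z / 4) ^+ 2 = Num.sqrt e ^+ 2 * rnorm z ^+ 2 / 16 by field.
  by rewrite (sqr_sqrtr (ltW e0)).
have E := @packet_residual _ _ _ _ _ Dz N1 hn0.
have {E} : rnorm z ^+ 2 <= p^-1 * (4 / T * riemann_output z h N) + L^-1 * energy z +
   e^-1 * (120 / T ^+ 2 * rnorm z ^+ 2 + 2 * (e * rnorm z ^+ 2 / 16)).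
  rewrite -[X in X <= _](packet_norm h Dz N1).
  have Dp k : D (packet z h N k) by exact: packet_dom.
  apply: le_trans (ler_sum _ (fun (k : 'I_N) _ =>
     coercive_split (packet_freq h N k) L0 e0 p0 H (Dp k))) _.
  rewrite !big_split /= -!mulr_sumr.
  rewrite (packet_sum h Dz N1 (@obs_hilbertY _ S) (@C_lin _ S)) (packet_energy h Dz N1).
  apply: lerD; first apply: lerD => //.
    rewrite ler_wpM2l ?invr_ge0 ?(ltW p0)// /riemann_output mulrA.
    (* The weights are at most [4 / N], so the weighted mean of the output is at most [4 / T] times
       its Riemann sum. *)
    have -> : 4 / T * h = 4 / N%:R by rewrite /h; field; rewrite !gt_eqF.
    rewrite mulr_sumr; apply: ler_sum => j _.
    by rewrite ler_wpM2r ?sqr_ge0// window_weight_le// ltnW.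
  rewrite ler_wpM2l ?invr_ge0 ?(ltW e0)//; apply: le_trans E _.
  have -> : N%:R * h = T by rewrite /h; field; rewrite gt_eqF.
  by rewrite lerD2l; lra.
rewrite frequencyE// => {}E.
have e1 : L^-1 * (frequency z * rnorm z ^+ 2) <= rnorm z ^+ 2 / 4.
  rewrite mulrA -[_ / 4]mulrC ler_wpM2r ?sqr_ge0//.
  by rewrite ler_pdivrMl//; lra.
have e2 : e^-1 * (120 / T ^+ 2 * rnorm z ^+ 2 + 2 * (e * rnorm z ^+ 2 / 16)) <=
   rnorm z ^+ 2 / 4 + rnorm z ^+ 2 / 8.
  rewrite mulrDr; apply: lerD.
    rewrite mulrA -[_ / 4]mulrC ler_wpM2r ?sqr_ge0//.
    rewrite ler_pdivrMl// ler_pdivrMr ?exprn_gt0//; lra.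
  by rewrite le_eqVlt; apply/orP; left; apply/eqP; field; rewrite gt_eqF.
have e3 : 3 / 8 * rnorm z ^+ 2 <= p^-1 * (4 / T * riemann_output z h N) by lra.
have e4 : 3 / 32 * (p * T) * rnorm z ^+ 2 <= riemann_output z h N.
  have pT : 0 <= p * T / 4 by rewrite divr_ge0// mulr_ge0// ltW.
  have := ler_wpM2l pT e3.
  have -> : p * T / 4 * (p^-1 * (4 / T * riemann_output z h N)) = riemann_output z h N.
    by field; rewrite !gt_eqF.
  lra.
move: HR; rewrite ler_norml => /andP[HR1 HR2].
have : 0 <= p * T * rnorm z ^+ 2 by rewrite !mulr_ge0 ?sqr_ge0 ?ltW.
rewrite -/h in HR1 HR2; lra.
Qed.

End MainInequality.

(** * Moduli and the time equation *)

Section Moduli.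
Context {R : realType}.
Implicit Types (eps psi : R -> R) (T lambda theta : R).

Lemma time_arg_ge0 theta0 T lambda : 0 < theta0 -> 0 < T -> 0 <= lambda ->
  0 <= theta0 * (T^-1 + lambda).
Proof. by move=> t0 T0 l0; rewrite mulr_ge0 ?(ltW t0)// addr_ge0// invr_ge0 ltW. Qed.

(** Strict even where [eps] is constant, thanks to the factor [T]; the argument of [eps] falls as
    [T] grows. *)
Lemma time_fun_incr theta0 eps lambda T T' : 0 < theta0 -> modulus eps ->
  0 <= lambda -> 0 < T -> T < T' ->
  T * eps (theta0 * (T^-1 + lambda)) < T' * eps (theta0 * (T'^-1 + lambda)).
Proof.
move=> t0 [_ dec pos] l0 T0 TT; have T'0 : 0 < T' by apply: lt_trans TT.
apply: (@lt_le_trans _ _ (T' * eps (theta0 * (T^-1 + lambda)))).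
  by rewrite ltr_pM2r ?pos// time_arg_ge0.
rewrite ler_wpM2l ?(ltW T'0)//; apply: dec; first exact: time_arg_ge0.
by rewrite ler_pM2l// lerD2r lef_pV2 ?posrE// ltW.
Qed.

Lemma time_eq_exists_unique theta0 theta1 eps lambda : 0 < theta0 -> 0 < theta1 ->
  modulus eps -> 0 <= lambda -> exists! T, solves_time_eq theta0 theta1 eps lambda T.
Proof.
move=> t0 t1 meps l0; have [ceps dec pos] := meps.
pose F T := T * eps (theta0 * (T^-1 + lambda)).
have e0 : 0 < eps 0 by apply: pos.
pose q := eps (theta0 * (1 + lambda)).
have q0 : 0 < q by apply: pos; rewrite mulr_ge0 ?addr_ge0 ?(ltW t0).
(* A bracket for the intermediate value theorem: [eps <= eps 0] at [a], while [b >= 1] keeps the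
   argument below [theta0 * (1 + lambda)], so that [eps] is at least [q] there. *)
pose a := theta1 / eps 0; pose b := Num.max 1 (theta1 / q).
have a0 : 0 < a by rewrite divr_gt0.
have b1 : 1 <= b by rewrite /b le_max lexx.
have b0 : 0 < b by apply: lt_le_trans b1.
have qe : q <= eps 0 by apply: dec => //; rewrite mulr_ge0 ?addr_ge0 ?(ltW t0).
have ab : a <= b.
  apply: (@le_trans _ _ (theta1 / q)); last by rewrite /b le_max lexx orbT.
  by rewrite ler_wpM2l ?(ltW t1)// lef_pV2.
have Fa : F a <= theta1.
  have -> : theta1 = a * eps 0 by rewrite /a divfK// gt_eqF.
  by rewrite /F ler_wpM2l ?(ltW a0)//; apply: dec => //; exact: time_arg_ge0.
have Fb : theta1 <= F b.
  apply: (@le_trans _ _ (b * q)).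
    by rewrite -ler_pdivrMr// /b le_max lexx orbT.
  rewrite /F ler_wpM2l ?(ltW b0)//; apply: dec; first exact: time_arg_ge0.
  by rewrite ler_pM2l// lerD2r invf_le1.
have cF : {within `[a, b], continuous F}.
  apply/subspace_continuousP => x /=; rewrite in_itv /= => /andP[ax xb].
  have x0 : 0 < x by apply: lt_le_trans ax.
  have cid : (fun y : R => y) @ within `[a, b] (nbhs x) --> x.
    exact: cvg_within.
  apply: cvgM => //.
  have cu : (fun y : R => theta0 * (y^-1 + lambda)) @ within `[a, b] (nbhs x)
     --> theta0 * (x^-1 + lambda).
    apply: cvgMr; apply: cvgD; last exact: cvg_cst.
    by apply: cvgV => //; rewrite gt_eqF.
  move/subspace_continuousP : ceps => /(_ (theta0 * (x^-1 + lambda))).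
  rewrite /= in_itv /= andbT => /(_ (time_arg_ge0 t0 x0 l0)) ce.
  apply: (@cvg_comp _ _ _ (fun y : R => theta0 * (y^-1 + lambda)) eps _ _ _ _ ce).
  move=> P; rewrite /within /= => HP.
  have H : \forall y \near nbhs x, `[a, b]%classic y ->
    `[0, +oo[%classic (theta0 * (y^-1 + lambda)) -> P (theta0 * (y^-1 + lambda)).
    exact: cu _ HP.
  suff : \forall y \near nbhs x, `[a, b]%classic y -> P (theta0 * (y^-1 + lambda)) by [].
  apply: filterS H => y Hy ay.
  apply: (Hy ay); move: ay; rewrite /= !in_itv /= andbT => /andP[ay _].
  by apply: time_arg_ge0 => //; exact: lt_le_trans ay.
have [|T Tab FT] := @IVT _ F a b theta1 ab cF.
  by rewrite ge_min le_max Fa Fb orbT.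
have T0 : 0 < T by move: Tab; rewrite in_itv /= => /andP[aT _]; exact: lt_le_trans aT.
exists T; split; first by split.
move=> T' [T'0 FT'].
case: (ltgtP T T') => // lt.
  by have := time_fun_incr t0 meps l0 T0 lt; rewrite -/(F T) FT FT' ltxx.
by have := time_fun_incr t0 meps l0 T'0 lt; rewrite -/(F T) FT FT' ltxx.
Qed.

Lemma obs_timeP theta0 theta1 eps lambda : 0 < theta0 -> 0 < theta1 ->
  modulus eps -> 0 <= lambda ->
  solves_time_eq theta0 theta1 eps lambda (obs_time theta0 theta1 eps lambda).
Proof.
move=> t0 t1 me l0; have [T [HT _]] := time_eq_exists_unique t0 t1 me l0.
by apply: (@getPex _ [set T | solves_time_eq theta0 theta1 eps lambda T]); exists T.
Qed.

Lemma obs_time_le theta0 theta1 eps lambda T : 0 < theta0 -> 0 < theta1 ->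
  modulus eps -> 0 <= lambda -> 0 < T ->
  (obs_time theta0 theta1 eps lambda <= T) = (theta1 <= T * eps (theta0 * (T^-1 + lambda))).
Proof.
move=> t0 t1 me l0 T0; have := obs_timeP t0 t1 me l0.
move: (obs_time _ _ _ _) => s [S0 HS].
rewrite -HS; apply/idP/idP; last first.
  by apply: contraLR; rewrite -!ltNge; exact: time_fun_incr.
rewrite le_eqVlt => /predU1P[<-|/(time_fun_incr t0 me l0 S0)/ltW //]; exact: lexx.
Qed.

(** At the solution for [lambda2], replacing [lambda2] by [lambda1] lowers the argument of [eps] and
    so raises the left side of the equation; [obs_time_le] concludes. *)
Lemma obs_time_incr theta0 theta1 eps lambda1 lambda2 : 0 < theta0 -> 0 < theta1 ->
  modulus eps -> 0 <= lambda1 -> lambda1 <= lambda2 ->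
  obs_time theta0 theta1 eps lambda1 <= obs_time theta0 theta1 eps lambda2.
Proof.
move=> t0 t1 me l1 l12; have l2 := le_trans l1 l12.
have := obs_timeP t0 t1 me l2.
move: (obs_time _ _ _ lambda2) => s [S0 HS].
rewrite obs_time_le// -HS ler_wpM2l ?(ltW S0)//.
have [_ dec _] := me; apply: dec; first exact: time_arg_ge0.
by rewrite ler_pM2l// lerD2l.
Qed.

(* [psi x] is the infimal convolution of [f] with the distance: it is
   1-Lipschitz and inherits monotonicity and positivity from [f]. *)
Lemma modulus_minorant (f : R -> R) : (forall x, 0 <= x -> 0 < f x) ->
  (forall x y, 0 <= x -> x <= y -> f y <= f x) ->
  exists2 psi, modulus psi & forall x, 0 <= x -> psi x <= f x.
Proof.
move=> fpos fdec.
pose E x := [set r | exists2 y, 0 <= y & r = f y + `|x - y|].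
have lbE x : lbound (E x) 0.
  by move=> r [y y0 ->]; rewrite addr_ge0// ltW// fpos.
have neE x : E x !=set0 by exists (f 0 + `|x - 0|), 0.
have infle x y : 0 <= y -> inf (E x) <= f y + `|x - y|.
  by move=> y0; apply: ge_inf; [exists 0|exists y].
have leinf x c : (forall y, 0 <= y -> c <= f y + `|x - y|) -> c <= inf (E x).
  by move=> H; apply: lb_le_inf => // r [y y0 ->]; exact: H.
have lip x y : inf (E x) <= inf (E y) + `|x - y|.
  rewrite -lerBlDr; apply: leinf => u u0; rewrite lerBlDr -addrA.
  apply: le_trans (infle x u u0) _; rewrite lerD2l addrC.
  have -> : x - u = (x - y) + (y - u) by ring.
  exact: ler_normD.
exists (fun x => inf (E x)); last first.
  by move=> x x0; have := infle x x x0; rewrite subrr normr0 addr0.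
split.
- apply: continuous_subspaceT => x; apply/cvgrPdist_le => e e0.
  near=> y.
  have xy : `|x - y| <= e.
    near: y; apply/nbhs_normP; exists e => //= y /= /ltW //.
  have := lip x y; have := lip y x; rewrite (distrC y x) => h1 h2.
  by rewrite ler_norml; apply/andP; split; lra.
- move=> x y x0 xy; apply: leinf => u u0.
  have y0 : 0 <= u + (y - x) by rewrite addr_ge0// subr_ge0.
  apply: le_trans (infle y _ y0) _.
  have -> : y - (u + (y - x)) = x - u by ring.
  by rewrite lerD2r; apply: fdec => //; rewrite lerDl subr_ge0.
- move=> x x0; have fx1 : 0 < f (x + 1) by apply: fpos; rewrite addr_ge0.
  (* Points [y] up to [x + 1] contribute at least [f (x + 1)], farther ones a distance of at least
     1. *)
  apply: (@lt_le_trans _ _ (Num.min 1 (f (x + 1)))); first by rewrite lt_min ltr01.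
  apply: leinf => y y0; rewrite ge_min.
  have [yx|xy] := lerP y (x + 1).
    by rewrite (le_trans (fdec _ _ y0 yx)) ?orbT// lerDl.
  apply/orP; left; have fy := fpos y y0.
  have : `|x - y| = y - x by rewrite distrC ger0_norm//; lra.
  by move=> ->; lra.
Unshelve. all: by end_near. Qed.

(** The running minimum [b] of the sequence gives a decreasing step function, to which
    [modulus_minorant] applies. *)
Lemma modulus_below_seq (a : nat -> R) : (forall n, 0 < a n) ->
  exists2 psi, modulus psi & forall x, 0 <= x -> psi x <= a (Num.trunc x).
Proof.
move=> a0; pose b := fix b n := if n is m.+1 then Num.min (b m) (a m.+1) else a 0%N.
have b0 n : 0 < b n by elim: n => //= n IH; rewrite lt_min IH a0.
have ba n : b n <= a n by case: n => //= n; rewrite ge_min lexx orbT.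
have bdec m n : (m <= n)%N -> b n <= b m.
  move=> /subnKC <-; elim: (n - m)%N => [|k IH]; first by rewrite addn0.
  by rewrite addnS /= ge_min IH.
have [|psi mpsi Hpsi] := @modulus_minorant (fun x => b (Num.trunc x)) (fun x _ => b0 _).
  by move=> x y x0 xy; apply: bdec; exact: le_truncn.
by exists psi => // x x0; apply: le_trans (Hpsi x x0) _.
Qed.

End Moduli.

(** * From observability to coercivity *)

Section ObservabilityToCoercivity.
Context {R : realType} (S : obs_system R).
Local Notation X := (obs_X S).
Local Notation D := (@obs_D _ S).
Local Notation A := (@obs_A _ S).
Local Notation U := (@obs_U _ S).
Local Notation C := (@obs_C _ S).
Implicit Types (z w u : X) (T h : R).

Lemma sqr_sum_le n (f : nat -> R) :
  (\sum_(j < n) f j) ^+ 2 <= n%:R * \sum_(j < n) f j ^+ 2.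
Proof.
elim: n => [|n IH]; first by rewrite !big_ord0 mulr0 expr0n.
rewrite !big_ord_recr /=; set s := \sum_(j < n) f j in IH *.
set q := \sum_(j < n) f j ^+ 2 in IH *.
have q0 : 0 <= q by apply: sumr_ge0 => j _; exact: sqr_ge0.
have [n0|n0] := posnP n.
  by rewrite /s /q n0 !big_ord0 !add0r mul1r.
have nr : 0 < n%:R :> R by rewrite ltr0n.
have h1 := sqr_ge0 (s - n%:R * f n).
have h2 : n%:R * (2 * (s * f n)) <= n%:R * (q + n%:R * f n ^+ 2) by nra.
rewrite ler_pM2l// in h2; rewrite -natr1; nra.
Qed.

Lemma sum_ord_mul N M (f : nat -> R) :
  \sum_(j < N) \sum_(i < M) f (j * M + i)%N = \sum_(l < N * M) f l.
Proof.
elim: N => [|N IH]; first by rewrite mul0n !big_ord0.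
by rewrite big_ord_recr /= IH mulSnr big_split_ord.
Qed.

Lemma out_energy_le T T' z : D z -> 0 <= T -> T <= T' -> out_energy T z <= out_energy T' z.
Proof.
move=> Dz T0 TT; rewrite -lee_fin -!output_energyE// /output_energy.
apply: ge0_subset_integral => //.
- apply: (measurable_int lebesgue_measure).
  apply: (@continuous_compact_integrable _ (output_sq z)); first exact: segment_compact.
  by apply: continuous_subspaceT; exact: output_sq_cont.
- by move=> x _; rewrite lee_fin sqr_ge0.
- by move=> x /=; rewrite !in_itv /= => /andP[-> /le_trans]; apply.
Qed.

(** The translates of [[0, h]] by multiples of [h] tile [[0, N h]], and the factor [N] is
    Cauchy-Schwarz for a sum of [N] terms. Both energies are compared through Riemann sums of the
    same step [h / M]. *)
Lemma out_energy_telescope N (a : nat -> R[i]) h u w :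
  (0 < N)%N -> 0 < h -> D u -> (forall j, Normc.normc (a j) = 1) ->
  w = \sum_(j < N) a j *: U (j%:R * h) u ->
  out_energy h w <= N%:R * out_energy (N%:R * h) u.
Proof.
move=> N0 h0 Du a1 wE.
have Nr : 0 < N%:R :> R by rewrite ltr0n.
have Dj j : D (a j *: U (j%:R * h) u) by apply: domZ; exact: (U_dom _ Du).1.
have Dw : D w by rewrite wE; apply: (@dom_sum _ S N (fun j => a j *: U (j%:R * h) u)).
have point s : output_sq w s <= N%:R * \sum_(j < N) output_sq u (j%:R * h + s).
  apply: le_trans (sqr_sum_le N (fun j => rnorm (C (U (j%:R * h + s) u)))).
  rewrite ler_sqr ?nnegrE ?rnorm_ge0//; last by apply: sumr_ge0 => j _; exact: rnorm_ge0.
  have -> : C (U s w) = \sum_(j < N) a j *: C (U (j%:R * h + s) u).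
    rewrite wE linear_sum /=.
    rewrite (lin_on_sum (@C_lin _ S) (f := fun j => U s (a j *: U (j%:R * h) u))).
      apply: eq_bigr => j _; rewrite linearZ /= -U_add addrC (lin_onZ (@C_lin _ S))//.
      exact: (U_dom _ Du).1.
    by move=> j _; exact: (U_dom _ (Dj j)).1.
  apply: le_trans (rnorm_sum _ (fun j => a j *: C (U (j%:R * h + s) u))) _.
  by apply: ler_sum => j _; rewrite rnormZ a1 mul1r.
have T0 : 0 < N%:R * h by rewrite mulr_gt0.
apply/ler_addgt0Pr => e e0.
have e2 : 0 < e / 2 by rewrite divr_gt0.
have eN : 0 < e / 2 / N%:R by rewrite divr_gt0.
have [M1 H1] := riemann_output_cvg Dw h0 e2.
have [M2 H2] := riemann_output_cvg Du T0 eN.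
pose M := maxn M1 M2.
have [M0 {}H1] := H1 M (leq_maxl _ _).
have [_ {}H2] := H2 (N * M)%N (leq_trans (leq_maxr _ _) (leq_pmull M N0)).
have Mr : 0 < M%:R :> R by rewrite ltr0n.
have : riemann_output w (h / M%:R) M <=
   N%:R * riemann_output u (N%:R * h / (N * M)%:R) (N * M).
  have -> : N%:R * h / (N * M)%:R = h / M%:R.
    by rewrite natrM; field; rewrite !gt_eqF.
  rewrite /riemann_output mulrCA ler_wpM2l ?divr_ge0 ?(ltW h0)//.
  rewrite -(sum_ord_mul N M (fun l => output_sq u (l%:R * (h / M%:R)))) exchange_big /=.
  rewrite mulr_sumr; apply: ler_sum => i _; apply: le_trans (point _) _.
  rewrite ler_wpM2l//; apply: ler_sum => j _.
  suff -> : (j * M + i)%:R * (h / M%:R) = j%:R * h + i%:R * (h / M%:R) by [].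
  by rewrite natrD natrM; field; rewrite gt_eqF.
move: H1 H2; rewrite !ler_norml => /andP[H1 H1'] /andP[H2 H2'] H3.
have : N%:R * riemann_output u (N%:R * h / (N * M)%:R) (N * M) <=
   N%:R * out_energy (N%:R * h) u + e / 2.
  have -> : e / 2 = N%:R * (e / 2 / N%:R) by field; rewrite gt_eqF.
  by rewrite -mulrDr ler_wpM2l//; lra.
lra.
Qed.

(* Duhamel: [w(t) = expi (- (t s)) U_t z - z] solves [w' = i (A - s) (w + z)]
   with [w(0) = 0], so that admissibility bounds [C w(t)] by [(A - s) z],
   although the latter need not be in the domain of [C]. *)
Lemma modulated_output_le T CT (t s : R) z : 0 < T -> 0 < CT ->
  (forall x, D x -> out_energy T x <= CT * rnorm x ^+ 2) ->
  D z -> 0 < t <= T ->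
  rnorm (C (expi (- (t * s)) *: U t z - z)) ^+ 2 <=
    T * CT * rnorm (A z - s%:C *: z) ^+ 2.
Proof.
move=> T0 CT0 HC Dz /andP[t0 tT].
set w := _ - z; set v := A z - _.
have Dw : D w by apply: domB => //; apply: domZ; exact: (U_dom _ Dz).1.
have v0 := rnorm_ge0 v.
suff key (e : R) : 0 < e -> e <= 1 ->
   rnorm (C w) ^+ 2 <= T * CT * (rnorm v + e) ^+ 2 + e.
  apply/ler_addgt0Pr => e e0.
  pose K := T * CT * (2 * rnorm v + 1) + 1.
  have K0 : 0 < K.
    by rewrite ltr_wpDl// mulr_ge0 ?mulr_ge0 ?ltW// ltr_wpDl// mulr_ge0.
  pose e' := Num.min 1 (e / K).
  have e'0 : 0 < e' by rewrite lt_min ltr01 divr_gt0.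
  have e'1 : e' <= 1 by rewrite ge_min lexx.
  have e'K : e' * K <= e by rewrite -ler_pdivlMr// ge_min lexx orbT.
  apply: le_trans (key e' e'0 e'1) _.
  have h1 : e' ^+ 2 <= e' by rewrite expr2 ler_piMl// ltW.
  have TC : 0 <= T * CT by rewrite mulr_ge0 ?ltW.
  have h2 := ler_wpM2l TC h1.
  rewrite /K in e'K; lra.
move=> e0 e1.
have e20 : 0 < e / 2 by rewrite divr_gt0.
have [d1 d10 H1] := output_sq_unif Dw e0.
have [d2 d20 H2] := diffq_cvg Dz e20.
pose d3 := e / 2 / (s ^+ 2 * rnorm z + 1).
have sz0 : 0 < s ^+ 2 * rnorm z + 1 by rewrite ltr_wpDl// mulr_ge0 ?sqr_ge0 ?rnorm_ge0.
have d30 : 0 < d3 by rewrite divr_gt0.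
pose d4 := (`|s| + 1)^-1.
have s10 : 0 < `|s| + 1 by rewrite ltr_wpDl.
have d40 : 0 < d4 by rewrite invr_gt0.
(* Four demands on the step [h]: continuity of the output of [w], the difference quotient at [z],
   the second-order term of [expi (h * s)], and [|h * s| <= 1]. *)
pose d := Num.min (Num.min d1 d2) (Num.min d3 d4).
have d0 : 0 < d by rewrite !lt_min d10 d20 d30 d40.
pose N := (Num.trunc (t / d)).+1.
have Nr : 0 < N%:R :> R by rewrite ltr0n.
pose h := t / N%:R.
have h0 : 0 < h by rewrite divr_gt0.
have hd : h < d.
  rewrite ltr_pdivrMr// -ltr_pdivrMl// mulrC; exact: truncnS_gt.
move: hd; rewrite !lt_min => /andP[/andP[hd1 hd2] /andP[hd3 hd4]].
have hn0 : h != 0 by rewrite gt_eqF.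
have Nh : N%:R * h = t by rewrite /h; field; rewrite gt_eqF.
pose u := expi (- (h * s)) *: U h z - z.
have Du : D u by apply: domB => //; apply: domZ; exact: (U_dom _ Dz).1.
pose a (j : nat) := expi (- (j%:R * (h * s))).
have a1 j : Normc.normc (a j) = 1 by exact: normc_expi.
(* Discrete Duhamel formula: [w] telescopes along the modulated orbit, each increment being a phase
   times a translate of the first one, [u]. *)
have wE : w = \sum_(j < N) a j *: U (j%:R * h) u.
  pose f (j : nat) := a j *: U (j%:R * h) z.
  have -> : w = f N - f 0%N.
    rewrite /f /a !mul0r oppr0 expi0 scale1r U0 Nh /w; congr (expi (- _) *: _ - _).
    by rewrite mulrA Nh.
  rewrite -(telescope_sumr f (leq0n N)) big_mkord; apply: eq_bigr => j _.
  rewrite /f /u [U _ (_ - z)]linearB [U _ (_ *: _)]linearZ /= -U_add.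
  rewrite [RHS]scalerBr scalerA /a -expiD.
  by congr (expi _ *: U _ z - _); rewrite -natr1; ring.
have E := out_energy_telescope (ltn0Sn _) h0 Du a1 wE.
rewrite Nh in E.
have {}E : out_energy h w <= N%:R * (CT * rnorm u ^+ 2).
  apply: le_trans E _; rewrite ler_wpM2l//; apply: le_trans (HC _ Du).
  by apply: out_energy_le => //; exact: ltW.
(* Up to a unimodular factor, [u / h] is [diffq h z - sg *: z], where [sg] differs from [s] by a
   term of order [h]. *)
have nu : rnorm u <= h * (rnorm v + e).
  pose sg := (- 'i * (h^-1)%:C) * (expi (h * s) - 1) : R[i].
  have uE : rnorm u = h * rnorm (diffq h z - sg *: z).
    have -> : diffq h z - sg *: z = (- 'i * (h^-1)%:C * expi (h * s)) *: u.
      rewrite /diffq /sg /u; move: (- 'i * _) => g.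
      rewrite -!scalerA -scalerBr; congr (_ *: _).
      rewrite scalerBl scale1r [RHS]scalerBr scalerA -expiD subrr expi0 scale1r.
      by rewrite opprB addrA subrK.
    rewrite rnormZ Normc.normcM normc_expi mulr1 Normc.normcM normc_real normcN.
    rewrite imagE /= expr0n /= add0r expr1n sqrtr1 mul1r gtr0_norm ?invr_gt0//.
    by rewrite mulrA divff// mul1r.
  rewrite uE ler_wpM2l ?(ltW h0)//.
  have -> : diffq h z - sg *: z = (diffq h z - A z) + (v + (s%:C - sg) *: z).
    by rewrite /v [(_ - sg) *: z]scalerBl [_ + (_ - sg *: z)]addrA subrK addrA subrK.
  apply: le_trans (rnormD _ _) _; rewrite addrC.
  have h2 : rnorm (diffq h z - A z) < e / 2 by apply: H2 => //; rewrite gtr0_norm.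
  have h3 : rnorm ((s%:C - sg) *: z) <= e / 2.
    rewrite rnormZ.
    have -> : s%:C - sg = ('i * (h^-1)%:C) * (expi (h * s) - 1 - (0 +i* (h * s))%C).
      rewrite /sg imagE; apply/eqP; rewrite eq_complex /=.
      by apply/andP; split; apply/eqP; field.
    rewrite Normc.normcM Normc.normcM normc_real imagE /= expr0n /= add0r expr1n.
    rewrite sqrtr1 mul1r gtr0_norm ?invr_gt0//.
    have hs1 : `|h * s| <= 1.
      rewrite normrM gtr0_norm//; apply: (@le_trans _ _ (d4 * (`|s| + 1))).
        by apply: ler_pM => //; [exact: ltW|exact: ltW|rewrite lerDl].
      by rewrite /d4 mulVf// gt_eqF.
    have := expi_second_order hs1; rewrite [Normc.normc]lock /= -lock => so.
    apply: (@le_trans _ _ (h^-1 * (h * s) ^+ 2 * rnorm z)).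
      by rewrite ler_wpM2r ?rnorm_ge0// ler_wpM2l// invr_ge0 ltW.
    have -> : h^-1 * (h * s) ^+ 2 * rnorm z = h * (s ^+ 2 * rnorm z) by field.
    apply: (@le_trans _ _ (d3 * (s ^+ 2 * rnorm z + 1))).
      apply: ler_pM => //; [exact: ltW| |exact: ltW|by rewrite lerDl].
      by rewrite mulr_ge0 ?sqr_ge0 ?rnorm_ge0.
    by rewrite /d3 divfK// gt_eqF.
  have := rnormD v ((s%:C - sg) *: z); lra.
have {}E : out_energy h w <= t * CT * (rnorm v + e) ^+ 2 * h.
  apply: le_trans E _.
  have -> : t * CT * (rnorm v + e) ^+ 2 * h = N%:R * (CT * (h * (rnorm v + e)) ^+ 2).
    by rewrite -Nh; ring.
  rewrite ler_wpM2l// ler_wpM2l ?(ltW CT0)//.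
  by rewrite ler_sqr ?nnegrE ?rnorm_ge0//; exact: le_trans (rnorm_ge0 u) nu.
have Hh s' t' : `|s' - t'| <= h -> `|output_sq w s' - output_sq w t'| <= e.
  by move=> st; apply: H1; apply: le_trans st (ltW hd1).
(* A Riemann sum with one point: the energy of [w] over the short interval [[0, h]] recovers [C w]
   at time 0. *)
have := @riemann_sum_error _ _ (output_sq_cont Dw) h e 1 (ltW h0) Hh.
rewrite big_ord_recr big_ord0 /= add0r !mul1r mul0r.
rewrite {2}/output_sq U0 ler_norml -/(out_energy h w) => /andP[E1 _].
have : h * rnorm (C w) ^+ 2 <= h * (t * CT * (rnorm v + e) ^+ 2 + e) by lra.
rewrite ler_pM2l// => /le_trans; apply; rewrite lerD2r.
by rewrite ler_wpM2r ?sqr_ge0// ler_wpM2r// ltW.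
Qed.

(** By [modulated_output_le], a small variance keeps [C z(t)] close to a phase times [C z] on
    [[0, T]]. The threshold on the variance makes the error absorb at most half of [c]. *)
Lemma observable_coercive_below T c L : 0 < T -> 0 < c ->
  (forall z, D z -> z != 0 -> frequency z <= L -> c * rnorm z ^+ 2 <= out_energy T z) ->
  exists e p, [/\ 0 < e, 0 < p & coercive_below S L e p].
Proof.
move=> T0 c0 H; have [CT CT0 HC] := admissible S T0.
exists (c / (4 * T ^+ 2 * CT)), (c / (4 * T)); split.
- by rewrite divr_gt0// !mulr_gt0// exprn_gt0.
- by rewrite divr_gt0// mulr_gt0.
move=> z Dz z0 fL.
set V := rnorm (A z) ^+ 2 / _ - _.
rewrite ltr_pdivlMr ?mulr_gt0 ?exprn_gt0// => VL.
have nz : 0 < rnorm z ^+ 2 by rewrite exprn_gt0// rnorm_gt0.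
pose K := 2 * rnorm (C z) ^+ 2 + 2 * (T * CT * (V * rnorm z ^+ 2)).
have pt t : 0 <= t <= T -> output_sq z t <= K.
  move=> /andP[t0 tT].
  pose s := frequency z; pose w := expi (- (t * s)) *: U t z - z.
  have Dt := (U_dom t Dz).1.
  have hw : rnorm (C w) ^+ 2 <= T * CT * (V * rnorm z ^+ 2).
    rewrite -varianceE//; move: t0; rewrite le_eqVlt => /predU1P[t0|t0].
      rewrite /w -t0 mul0r oppr0 expi0 scale1r U0 subrr (lin_on0 (@C_lin _ S)).
      by rewrite rnorm0 expr0n /= mulr_ge0 ?sqr_ge0 ?mulr_ge0 ?ltW.
    by apply: modulated_output_le => //; rewrite t0 tT.
  have -> : output_sq z t = rnorm (C z + C w) ^+ 2.
    rewrite -(lin_onD (@C_lin _ S))//; last by apply: domB => //; exact: domZ.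
    by rewrite /w addrC subrK (lin_onZ (@C_lin _ S))// rnormZ normc_expi mul1r.
  apply: le_trans (rnormD_sq _ _) _; rewrite /K; lra.
have : out_energy T z <= T * K.
  apply/ler_addgt0Pr => e e0; have [N0 HN] := riemann_output_cvg Dz T0 e0.
  have [N1] := HN N0 (leqnn _); rewrite ler_norml => /andP[_ E].
  have Nr : 0 < N0%:R :> R by rewrite ltr0n.
  suff : riemann_output z (T / N0%:R) N0 <= T * K by lra.
  apply: (@le_trans _ _ (T / N0%:R * \sum_(j < N0) K)).
    rewrite ler_wpM2l ?divr_ge0 ?(ltW T0)//; apply: ler_sum => j _; apply: pt.
    rewrite mulr_ge0 ?divr_ge0 ?(ltW T0)//= mulrCA ger_pMr//.
    by rewrite ler_pdivrMr// mul1r ler_nat ltnW.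
  by rewrite sumr_const card_ord -[_ *+ N0]mulr_natr; rewrite le_eqVlt; apply/orP;
    left; apply/eqP; field; rewrite gt_eqF.
have := H z Dz z0 fL.
rewrite mulrAC ler_pdivrMr ?mulr_gt0// /K => h1 h2.
have h3 : V * (4 * T ^+ 2 * CT) * rnorm z ^+ 2 <= c * rnorm z ^+ 2.
  by rewrite ler_wpM2r ?ltW.
lra.
Qed.

End ObservabilityToCoercivity.

(** * Polynomials of the group *)

Section FunctionalCalculus.
Context {R : realType} (S : obs_system R).
Local Notation X := (obs_X S).
Local Notation D := (@obs_D _ S).
Local Notation A := (@obs_A _ S).
Local Notation U := (@obs_U _ S).
Local Notation dX := (obs_dotX S).
Implicit Types (x z : X) (h : R).

Lemma shift_Re_le x (s : R[i]) : D x ->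
  `|energy x - complex.Re s * rnorm x ^+ 2| <= rnorm (A x - s *: x) * rnorm x.
Proof.
move=> Dx; apply: le_trans (cauchy_schwarz (@obs_hilbertX _ S) _ _).
rewrite dotDl dotNl dotZl.
rewrite (dot_rnorm (@obs_hilbertX _ S)) /energy.
by case: s (dX _ _) => u v [p q] /=; rewrite le_eqVlt; apply/orP; left; apply/eqP; congr `|_|; ring.
Qed.

(** [A] is symmetric, so the squared residual for [s] is the one for its real part plus the
    contribution of its imaginary part. *)
Lemma shift_Im_le x (s : R[i]) : D x ->
  complex.Im s ^+ 2 * rnorm x ^+ 2 <= rnorm (A x - s *: x) ^+ 2.
Proof.
move=> Dx; have := sqr_ge0 (rnorm (A x - (complex.Re s)%:C *: x)).
rewrite !normsq_A_shift// !normc_sq /= expr0n /= addr0; lra.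
Qed.

Lemma cos1_le : cos 1 <= 7 / 8 :> R.
Proof.
have -> : cos 1 = 1 - 2 * sin (1 / 2) ^+ 2 :> R.
  rewrite {1}(_ : 1 = (1 / 2) *+ 2); last by rewrite mulr2n; lra.
  by rewrite cos_mulr2n cos2sin2 mulr2n; ring.
have h1 : 1 / 2 / 2 <= sin (1 / 2) :> R by apply: sin_ge_half; lra.
have : (1 / 2 / 2) ^+ 2 <= sin (1 / 2) ^+ 2 :> R by rewrite ler_sqr ?nnegrE; lra.
lra.
Qed.

Lemma shifted_freqE h al : (- 'i * (h^-1)%:C) * (expi al - 1) =
  (sin al / h +i* ((1 - cos al) / h))%C :> R[i].
Proof.
rewrite imagE; apply/eqP; rewrite eq_complex /=.
by apply/andP; split; apply/eqP; ring.
Qed.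

(* Frequencies [al / h] with [al <= 1] are comparable to the real part of the
   shift; the others are far from the positive half-line. *)
Lemma packet_symbol_le h al G a b r1 m0 kap x :
  0 < h -> 0 <= al < pi *+ 2 -> 0 < m0 -> 8 * h * m0 <= 1 -> 0 < kap ->
  0 <= a -> 0 <= b -> 0 <= G -> G <= r1 -> G <= a + b * (al / h) ->
  (forall y, D y -> m0 * rnorm y ^+ 2 <= energy y) -> D x ->
  G * rnorm x ^+ 2 <= a * rnorm x ^+ 2 + 2 * b * energy x
    + 2 * b * kap * rnorm x ^+ 2 + (2 * b / kap + r1 / m0 ^+ 2) *
      rnorm (A x - ((- 'i * (h^-1)%:C) * (expi al - 1)) *: x) ^+ 2.
Proof.
move=> h0 /andP[al0 al2] m00 hm kap0 a0 b0 G0 Gr Gab pos Dx.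
rewrite shifted_freqE; set s := (_ +i* _)%C; set n := rnorm (A x - _).
have x0 := rnorm_ge0 x; have n0 : 0 <= n := rnorm_ge0 _.
have E0 := energy_ge0 Dx.
have r10 : 0 <= r1 := le_trans G0 Gr.
have t1 : 0 <= a * rnorm x ^+ 2 by rewrite mulr_ge0 ?sqr_ge0.
have t2 : 0 <= 2 * b * energy x by rewrite !mulr_ge0.
have t3 : 0 <= 2 * b * kap * rnorm x ^+ 2.
  by rewrite mulr_ge0 ?sqr_ge0// mulr_ge0 ?(ltW kap0)// mulr_ge0.
have t4 : 0 <= 2 * b / kap * n ^+ 2.
  by rewrite mulr_ge0 ?sqr_ge0// divr_ge0 ?(ltW kap0)// mulr_ge0.
have t5 : 0 <= r1 / m0 ^+ 2 * n ^+ 2.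
  by rewrite mulr_ge0 ?sqr_ge0// divr_ge0 ?sqr_ge0.
have := shift_Re_le s Dx; rewrite -/n /= ler_norml => /andP[Re1 Re2].
have Im := shift_Im_le s Dx; rewrite -/n /= in Im.
rewrite mulrDl.
have far : m0 ^+ 2 * rnorm x ^+ 2 <= n ^+ 2 -> G * rnorm x ^+ 2 <= r1 / m0 ^+ 2 * n ^+ 2.
  move=> H; apply: (@le_trans _ _ (r1 * rnorm x ^+ 2)); first by rewrite ler_wpM2r ?sqr_ge0.
  by rewrite -mulrA ler_wpM2l// ler_pdivlMl// exprn_gt0.
have [al1|al1] := lerP al 1.
  have sal : al / 2 <= sin al by apply: sin_ge_half; rewrite al0 al1.
  have h1 : al / h <= 2 * (sin al / h).
    by rewrite mulrA ler_wpM2r ?invr_ge0 ?(ltW h0)//; lra.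
  have h2 : G * rnorm x ^+ 2 <= (a + b * (2 * (sin al / h))) * rnorm x ^+ 2.
    rewrite ler_wpM2r ?sqr_ge0//; apply: le_trans Gab _; rewrite lerD2l.
    by rewrite ler_wpM2l.
  have h3 : n * rnorm x <= kap * rnorm x ^+ 2 + kap^-1 * n ^+ 2.
    have := sqr_ge0 (kap * rnorm x - n).
    rewrite -(@pmulr_rge0 _ kap^-1) ?invr_gt0// => h4.
    have h5 : kap^-1 * (kap * rnorm x - n) ^+ 2 =
       kap * rnorm x ^+ 2 - 2 * (n * rnorm x) + kap^-1 * n ^+ 2.
      by field; rewrite gt_eqF.
    have : 0 <= n * rnorm x by rewrite mulr_ge0.
    lra.
  have h6 : sin al / h * rnorm x ^+ 2 <= 2 * energy x - energy x + (kap * rnorm x ^+ 2 + kap^-1 * n ^+ 2).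
    lra.
  have := ler_wpM2l (_ : 0 <= 2 * b) h6; rewrite mulr_ge0// => /(_ isT).
  lra.
(* For phases between 1 and [pi] the imaginary part of the shift is at least [1 / (8 * h)], hence at
   least [m0]. *)
have [alp|alp] := lerP al pi.
  suff : G * rnorm x ^+ 2 <= r1 / m0 ^+ 2 * n ^+ 2 by lra.
  apply: far; apply: le_trans Im; rewrite ler_wpM2r ?sqr_ge0// ler_sqr ?nnegrE ?(ltW m00)//.
    rewrite ler_pdivlMr//.
    have : cos al <= cos 1.
      rewrite ltW// ltr_cos// in_itv /=; apply/andP; split=> //; last exact: le_trans (ltW al1) alp.
    have := cos1_le; lra.
  by rewrite divr_ge0 ?(ltW h0)// subr_ge0 cos_le1.
suff : G * rnorm x ^+ 2 <= r1 / m0 ^+ 2 * n ^+ 2 by lra.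
apply: far.
(* For phases beyond [pi] the real part of the shift is nonpositive, whereas the energy is at least
   [m0 * rnorm x ^+ 2]: the residual is again large. *)
have sal : sin al <= 0.
  have -> : al = (al - pi) + pi by ring.
  rewrite sinDpi oppr_le0 sin_ge0_pi//.
  by move: al2; rewrite mulr2n => al2; apply/andP; split; lra.
have sh : sin al / h * rnorm x ^+ 2 <= 0.
  by rewrite mulr_le0_ge0 ?sqr_ge0// mulr_le0_ge0// invr_ge0 ltW.
have px := pos x Dx.
have nx : m0 * rnorm x ^+ 2 <= n * rnorm x by lra.
have [x00|x00] := eqVneq (rnorm x) 0; first by rewrite x00 expr0n /= mulr0 sqr_ge0.
have xp : 0 < rnorm x by rewrite lt_def x00.
have : m0 * rnorm x <= n by rewrite expr2 mulrA ler_pM2r// in nx.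
by rewrite -exprMn ler_sqr ?nnegrE// mulr_ge0// ltW.
Qed.

(** The function of [A] whose symbol at frequency [mu] is the sum of the
    [c j * expi (j%:R * (d * mu))]. *)
Definition group_poly (n : nat) (c : nat -> R[i]) (d : R) x : X :=
  \sum_(j < n) c j *: U (j%:R * d) x.

Lemma group_poly_dom n c d x : D x -> D (group_poly n c d x).
Proof.
move=> Dx; apply: (@dom_sum _ S n (fun j => c j *: U (j%:R * d) x)) => j _.
by apply: domZ; exact: (U_dom _ Dx).1.
Qed.

Lemma group_poly_lin n c d : linear_on D (group_poly n c d).
Proof.
move=> a x y _ _; rewrite /group_poly scaler_sumr -big_split /=.
by apply: eq_bigr => j _; rewrite linearP scalerDr !scalerA [c j * a]mulrC.
Qed.

Lemma group_poly_comm n c d t x : group_poly n c d (U t x) = U t (group_poly n c d x).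
Proof.
rewrite /group_poly linear_sum; apply: eq_bigr => j _.
by rewrite [RHS]linearZ /= -!U_add addrC.
Qed.

(** Telescoping: each of the [n] steps repeats the error of one step, up to an isometry and a
    phase. *)
Lemma iter_shift_le n h al x :
  rnorm (U (n%:R * h) x - expi (n%:R * al) *: x) <= n%:R * rnorm (U h x - expi al *: x).
Proof.
elim: n => [|n IH].
  by rewrite !mul0r expi0 scale1r U0 subrr rnorm0.
have -> : U (n.+1%:R * h) x - expi (n.+1%:R * al) *: x =
    U (n%:R * h) (U h x - expi al *: x) +
    expi al *: (U (n%:R * h) x - expi (n%:R * al) *: x).
  rewrite [U _ (_ - _)]linearB [U _ (_ *: _)]linearZ /= -U_add.
  rewrite [expi al *: (_ - _)]scalerBr addrA subrK scalerA -expiD -natr1.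
  by congr (U _ _ - expi _ *: _); ring.
apply: le_trans (rnormD _ _) _.
by rewrite rnormU rnormZ normc_expi mul1r -natr1 mulrDl mul1r addrC lerD2r.
Qed.

Lemma group_poly_shift_le n (c : nat -> R[i]) m h al x :
  rnorm (group_poly n c (m%:R * h) x - (\sum_(j < n) c j * expi (j%:R * (m%:R * al))) *: x)
  <= (\sum_(j < n) Normc.normc (c j) * (j * m)%:R) * rnorm (U h x - expi al *: x).
Proof.
rewrite /group_poly scaler_suml -sumrB mulr_suml.
apply: le_trans (rnorm_sum _ (fun j => c j *: U (j%:R * (m%:R * h)) x -
  (c j * expi (j%:R * (m%:R * al))) *: x)) _.
apply: ler_sum => j _; rewrite -scalerA -scalerBr rnormZ -mulrA.
rewrite ler_wpM2l ?normc_ge0// !mulrA -natrM.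
exact: iter_shift_le.
Qed.

(* On a packet the group acts almost as a scalar, so that a pointwise bound of
   the symbol on the positive half-line carries over to the operator. *)
Lemma group_poly_le n (c : nat -> R[i]) d a b z : 0 < d -> 0 <= a -> 0 <= b ->
  (forall mu : R, 0 <= mu ->
    Normc.normc (\sum_(j < n) c j * expi (j%:R * (d * mu))) ^+ 2 <= a + b * mu) ->
  D z -> rnorm (group_poly n c d z) ^+ 2 <= 2 * a * rnorm z ^+ 2 + 4 * b * energy z.
Proof.
move=> d0 a0 b0 Hc Dz; apply/ler_addgt0Pr => e e0.
have [m0 m00 pos] := @obs_positive _ S.
have z20 := sqr_ge0 (rnorm z).
pose q := b * rnorm z ^+ 2 + 1.
have q0 : 0 < q by rewrite ltr_wpDl// mulr_ge0.
pose kap := e / (12 * q).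
have kap0 : 0 < kap by rewrite divr_gt0// mulr_gt0.
pose r1 := (\sum_(j < n) Normc.normc (c j)) ^+ 2.
have r10 : 0 <= r1 by exact: sqr_ge0.
pose K := 2 * b / kap + r1 / m0 ^+ 2.
have K0 : 0 <= K.
  by rewrite addr_ge0// divr_ge0 ?sqr_ge0 ?(ltW kap0)// mulr_ge0.
have K10 : 0 < K + 1 by rewrite ltr_wpDl.
have rho0 : 0 < Num.sqrt (e / (12 * (K + 1))) by rewrite sqrtr_gt0 divr_gt0// mulr_gt0.
have [d1 d10 Hd] := diffq_cvg Dz rho0.
pose d2 := Num.min d1 (8 * m0)^-1.
have d20 : 0 < d2 by rewrite lt_min d10 invr_gt0 mulr_gt0.
(* The packet step [h] divides [d], so that [U d] is a power of [U h] and acts on packets by a power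
   of the same phase. *)
pose m := (Num.trunc (d / d2)).+1.
have mr : 0 < m%:R :> R by rewrite ltr0n.
pose h := d / m%:R.
have h0 : 0 < h by rewrite divr_gt0.
have hn0 : h != 0 by rewrite gt_eqF.
have mh : m%:R * h = d by rewrite /h; field; rewrite gt_eqF.
have : h < d2 by rewrite ltr_pdivrMr// -ltr_pdivrMl// mulrC; exact: truncnS_gt.
rewrite lt_min => /andP[hd1 hd2].
have hm : 8 * h * m0 <= 1.
  rewrite mulrAC -ler_pdivlMl ?mulr_gt0// mulr1; exact: ltW.
have rho : 4 * K * rnorm (diffq h z - A z) ^+ 2 <= e / 3.
  have : rnorm (diffq h z - A z) ^+ 2 <= Num.sqrt (e / (12 * (K + 1))) ^+ 2.
    by rewrite ler_sqr ?nnegrE ?rnorm_ge0 ?sqrtr_ge0// ltW// Hd// gtr0_norm.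
  rewrite sqr_sqrtr; last by rewrite divr_ge0 ?mulr_ge0 ?(ltW e0) ?(ltW K10).
  rewrite ler_pdivlMr ?mulr_gt0//; have := sqr_ge0 (rnorm (diffq h z - A z)); lra.
pose K2 := \sum_(j < n) Normc.normc (c j) * (j * m)%:R.
have K20 : 0 <= K2 by apply: sumr_ge0 => j _; rewrite mulr_ge0 ?normc_ge0.
pose Q := (240 * K / h ^+ 2 + 120 * K2 ^+ 2) * rnorm z ^+ 2.
have Q0 : 0 <= Q.
  apply: mulr_ge0 => //; apply: addr_ge0.
    exact: divr_ge0 (mulr_ge0 (ler0n _ _) K0) (sqr_ge0 _).
  exact: mulr_ge0 (ler0n _ _) (sqr_ge0 _).
(* No observation time is prescribed here: with [h] fixed, a larger [N] lengthens the window
   [N * h], and the shift errors summed over packets decay like [1 / N ^+ 2]. *)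
pose N := (Num.trunc (3 * Q / e)).+2.
have N1 : (1 < N)%N by [].
have Nr : 1 <= N%:R :> R by rewrite ler1n.
have N0 : 0 < N%:R :> R by rewrite ltr0n.
have QN : Q / N%:R ^+ 2 <= e / 3.
  rewrite ler_pdivrMr ?exprn_gt0//.
  have h1 : 3 * Q / e < N%:R.
    by apply: lt_trans (truncnS_gt _) _; rewrite ltr_nat.
  rewrite ltr_pdivrMr// in h1.
  have h2 : N%:R <= N%:R ^+ 2 :> R by rewrite expr2 ler_peMl// ltW.
  have := ler_wpM2l (ltW e0) h2; lra.
pose G k := Normc.normc (\sum_(j < n) c j * expi (j%:R * (m%:R * phase N k))) ^+ 2.
have Gr k : G k <= r1.
  rewrite ler_sqr ?nnegrE ?normc_ge0//; last by apply: sumr_ge0 => j _; exact: normc_ge0.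
  apply: le_trans (normc_sum n (fun j => c j * expi (j%:R * (m%:R * phase N k)))) _.
  by apply: ler_sum => j _; rewrite Normc.normcM normc_expi mulr1.
have Gab k : (k < N)%N -> G k <= a + b * (phase N k / h).
  move=> kN; have /andP[p0 _] := @phase_ge0_lt R N N1 k kN.
  have -> : G k = Normc.normc (\sum_(j < n) c j * expi (j%:R * (d * (phase N k / h)))) ^+ 2.
    rewrite /G; congr (Normc.normc _ ^+ 2); apply: eq_bigr => j _; congr (_ * expi (_ * _)).
    by rewrite -mh; field; rewrite gt_eqF.
  by apply: Hc; rewrite divr_ge0// ltW.
pose P k := packet z h N k.
have DP k : D (P k) by exact: packet_dom.
have step (k : 'I_N) : rnorm (group_poly n c d (P k)) ^+ 2 <=
   2 * (a * rnorm (P k) ^+ 2 + 2 * b * energy (P k)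
    + 2 * b * kap * rnorm (P k) ^+ 2 +
     K * rnorm (A (P k) - packet_freq h N k *: P k) ^+ 2) +
   2 * K2 ^+ 2 * rnorm (U h (P k) - expi (phase N k) *: P k) ^+ 2.
  set s := \sum_(j < n) c j * expi (j%:R * (m%:R * phase N k)).
  have -> : group_poly n c d (P k) = s *: P k + (group_poly n c d (P k) - s *: P k).
    by rewrite addrC subrK.
  apply: le_trans (rnormD_sq _ _) _; apply: lerD.
    rewrite ler_pM2l// rnormZ exprMn -/(G k).
    by apply: packet_symbol_le => //; [exact: phase_ge0_lt|exact: sqr_ge0|exact: Gab].
  rewrite -mulrA ler_pM2l// -exprMn ler_sqr ?nnegrE ?rnorm_ge0//.
    by have := group_poly_shift_le n c m h (phase N k) (P k); rewrite mh.
  by rewrite mulr_ge0 ?rnorm_ge0.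
have sumP : \sum_(k < N) rnorm (group_poly n c d (P k)) ^+ 2 = rnorm (group_poly n c d z) ^+ 2.
  rewrite (packet_sum h Dz N1 (@obs_hilbertX _ S) (@group_poly_lin n c d)).
  under eq_bigr do rewrite group_poly_comm rnormU.
  by rewrite -mulr_suml sum_window_weight// mul1r.
rewrite -sumP; apply: le_trans (ler_sum _ (fun k _ => step k)) _.
rewrite big_split /= -!mulr_sumr !big_split /= -!mulr_sumr.
rewrite (packet_norm h Dz N1) (packet_energy h Dz N1).
have R1 := packet_residual Dz N1 hn0.
have R2 := packet_shift z h N1.
have R1' := ler_wpM2l K0 R1.
have R2' := ler_wpM2l (mulr_ge0 (ler0n _ 2) (sqr_ge0 K2)) R2.
have kapE : 4 * b * kap * rnorm z ^+ 2 <= e / 3.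
  have : kap * (12 * q) = e by rewrite /kap divfK// gt_eqF// mulr_gt0.
  rewrite /q => kq; clear -kq b0 z20 e0 kap0; lra.
have QE : Q / N%:R ^+ 2 = 2 * (K * (120 / (N%:R * h) ^+ 2 * rnorm z ^+ 2)) +
    2 * K2 ^+ 2 * (60 / N%:R ^+ 2 * rnorm z ^+ 2).
  by rewrite /Q; field; rewrite hn0 gt_eqF.
rewrite /P; clear -R1' R2' kapE QE QN rho; lra.
Qed.

End FunctionalCalculus.

(** * Approximation of characters on the half-line *)

Section SymbolApproximation.
Context {R : realType}.
Local Notation C := R[i].
Local Notation nc := (@Normc.normc R).
Implicit Types (t x : R) (k m n : nat).

Lemma expi_so x : nc (expi x - 1 - (0 +i* x)%C) <= 3 * x ^+ 2.
Proof.
have [x1|x1] := lerP `|x| 1.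
  by apply: le_trans (expi_second_order x1) _; have := sqr_ge0 x; lra.
apply: (@le_trans _ _ (2 + `|x|)).
  apply: le_trans (normcD _ _) _; rewrite normcN; apply: lerD.
    by apply: le_trans (normcD _ _) _; rewrite normcN normc_expi Normc.normc1.
  by rewrite /= expr0n /= add0r sqrtr_sqr.
rewrite -real_normK ?num_real//; nra.
Qed.

Lemma normcX_sub_le (u v : C) n : nc u <= 1 -> nc v <= 1 ->
  nc (u ^+ n - v ^+ n) <= n%:R * nc (u - v).
Proof.
move=> u1 v1; elim: n => [|n IH]; first by rewrite subrr Normc.normc0 mul0r.
have -> : u ^+ n.+1 - v ^+ n.+1 = u * (u ^+ n - v ^+ n) + v ^+ n * (u - v).
  by rewrite !exprS; ring.
apply: le_trans (normcD _ _) _; rewrite !Normc.normcM normcX.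
have h1 : nc u * nc (u ^+ n - v ^+ n) <= nc (u ^+ n - v ^+ n).
  by rewrite ler_piMl// normc_ge0.
have h2 : nc v ^+ n * nc (u - v) <= nc (u - v).
  by rewrite ler_piMl ?normc_ge0// exprn_ile1 ?normc_ge0.
rewrite -natr1; lra.
Qed.

Fixpoint logistic k t : R :=
  if k is k'.+1 then 4 * logistic k' t * (1 - logistic k' t) else sin t.

Lemma logistic_itv k t : 0 <= t <= pi -> 0 <= logistic k t <= 1.
Proof.
move=> tp; elim: k => [|k /andP[h0 h1]] /=; first by rewrite sin_ge0_pi// sin_le1.
have := sqr_ge0 (2 * logistic k t - 1); have : 0 <= logistic k t * (1 - logistic k t).
  by rewrite mulr_ge0 ?subr_ge0.
by move=> *; apply/andP; split; lra.
Qed.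

(** The factor 8 closes the induction: [|x| <= M / 8] and [8 <= M] give
    [4 |x| (1 + |x|) <= M ^+ 2 / 8]. *)
Lemma logistic_bound k t : `|logistic k t| * 8 <= 8 ^+ (2 ^ k).
Proof.
elim: k => [|k IH] /=; first by rewrite expr1 ler_piMl// sin_max.
rewrite expnS mulnC exprM expr2; set M := 8 ^+ _ in IH *.
have M8 : 8 <= M by apply: ler_eXnr; rewrite ?expn_gt0 ?ler1n.
have x0 := normr_ge0 (logistic k t).
have h : `|1 - logistic k t| <= 1 + `|logistic k t|.
  by apply: le_trans (ler_normB _ _) _; rewrite normr1.
rewrite !normrM (ger0_norm (ler0n _ 4)).
move: (`|1 - _|) (normr_ge0 (1 - logistic k t)) h IH x0 => y y0.
move: `|_| => x h IH x0.
have h1 : x * y <= x * (1 + x) by rewrite ler_wpM2l.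
have h2 : x * x <= M / 8 * (M / 8) by apply: ler_pM => //; lra.
have h3 : 8 * M <= M * M by rewrite ler_wpM2r//; lra.
lra.
Qed.

(** The map [x |-> 4 x (1 - x)] fixes 0 with slope 4, and the sine has slope 1 there. *)
Lemma logistic_so k : exists2 K : R, 0 <= K &
  forall t, 0 <= t <= 1 -> `|logistic k t - 4 ^+ k * t| <= K * t ^+ 2.
Proof.
elim: k => [|k [K K0 IH]].
  exists 1 => // t /andP[t0 t1]; rewrite /= expr0 !mul1r.
  have : `|t| <= 1 by rewrite ger0_norm.
  move/expi_second_order; apply: le_trans.
  by apply: le_trans (normc_geIm _); rewrite /= subr0.
exists (4 * K + 4 * (4 ^+ k + K) ^+ 2).
  by have := sqr_ge0 (4 ^+ k + K); lra.
move=> t /andP[t0 t1]; have := IH t; rewrite t0 t1 => /(_ isT) {}IH.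
set y := 4 ^+ k in IH *; have y0 : 0 <= y by exact: exprn_ge0.
rewrite /= exprS -/y; set x := logistic k t in IH *.
have -> : 4 * x * (1 - x) - 4 * y * t = 4 * (x - y * t) - 4 * x ^+ 2 by ring.
apply: le_trans (ler_normB _ _) _; rewrite [leRHS]mulrDl; apply: lerD.
  by rewrite normrM (ger0_norm (ler0n _ 4)) -mulrA ler_wpM2l.
rewrite normrM (ger0_norm (ler0n _ 4)) normrX -mulrA ler_wpM2l// -exprMn.
have tt : t ^+ 2 <= t by rewrite expr2 ler_piMl.
have h : `|x| <= (y + K) * t.
  have -> : x = (x - y * t) + y * t by ring.
  apply: le_trans (ler_normD _ _) _; rewrite (@ger0_norm _ (y * t)) ?mulr_ge0//.
  have := ler_wpM2l K0 tt; lra.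
by rewrite lerXn2r ?nnegrE// mulr_ge0// addr_ge0.
Qed.

(* Its powers compensate the growth of [logistic k] outside [0, pi]. *)
Definition dirichlet m t : C :=
  (m.+1%:R^-1)%:C * \sum_(j < m.+1) expi (16 * t / m%:R) ^+ j.

Lemma dirichlet_le1 m t : nc (dirichlet m t) <= 1.
Proof.
rewrite Normc.normcM normc_real ger0_norm ?invr_ge0//.
rewrite ler_pdivrMl ?ltr0n// mulr1.
apply: le_trans (normc_sum m.+1 (fun j => expi (16 * t / m%:R) ^+ j)) _.
under eq_bigr do rewrite normcX normc_expi expr1n.
by rewrite sumr_const card_ord.
Qed.

(** The geometric sum is at most [2 / |expi al - 1| <= 4 / al]; after division by [m + 1] this is at
    most [1 / (4 t)]. The bound [16 * t <= m] keeps [al] in the range of [sin_ge_half]. *)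
Lemma dirichlet_small m t : (0 < m)%N -> 2 <= t -> 16 * t <= m%:R ->
  nc (dirichlet m t) <= 8^-1.
Proof.
move=> m0 t2 tm; have mr : 0 < m%:R :> R by rewrite ltr0n.
rewrite /dirichlet; set al := 16 * t / m%:R; set s := \sum_(j < _) _.
have al1 : al <= 1 by rewrite ler_pdivrMr// mul1r.
have al0 : 0 < al by rewrite divr_gt0//; lra.
have h1 : al / 2 <= nc (expi al - 1).
  apply: le_trans (normc_geIm _); apply: le_trans (ler_norm _).
  by rewrite /= subr0; apply: sin_ge_half; rewrite al1 ltW.
have h2 : nc (expi al - 1) * nc s <= 2.
  rewrite -Normc.normcM -subrX1; apply: le_trans (normcD _ _) _.
  by rewrite normcN normcX normc_expi expr1n Normc.normc1.
have h3 : al / 2 * nc s <= 2 by apply: le_trans h2; rewrite ler_wpM2r ?normc_ge0.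
have alE : al * m%:R = 16 * t by rewrite /al divfK// gt_eqF.
rewrite Normc.normcM normc_real ger0_norm ?invr_ge0// ler_pdivrMl ?ltr0n//.
have := normc_ge0 s; rewrite -natr1; move: (nc s) h3 => y h3 y0.
have h4 : al * m%:R * y <= 4 * m%:R.
  by rewrite mulrAC ler_pM2r//; lra.
rewrite alE in h4.
have h5 : 2 * y <= t * y by rewrite ler_wpM2r.
lra.
Qed.

(** First-order expansion at 0, with value 1 and slope [l]. The interval is fixed and the constant
    explicit, to track uniformity in [m]. *)
Definition so (l : C) (K : R) (f : R -> C) := forall t, 0 <= t <= 16^-1 ->
  nc (f t - 1 - l * t%:C) <= K * t ^+ 2.

Lemma so_expi (w : R) : so (0 +i* w)%C (3 * w ^+ 2) (fun t => expi (w * t)).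
Proof.
move=> t _; have := expi_so (w * t); rewrite exprMn mulrA; apply: le_trans.
rewrite le_eqVlt; apply/orP; left; apply/eqP; congr nc; congr (_ - _).
by apply/eqP; rewrite eq_complex /=; apply/andP; split; apply/eqP; ring.
Qed.

Lemma so_mul l1 l2 K1 K2 f g : 0 <= K1 -> 0 <= K2 -> so l1 K1 f -> so l2 K2 g ->
  so (l1 + l2) (nc l1 * nc l2 + K1 * (1 + nc l2 + K2) + K2 * (1 + nc l1))
    (fun t => f t * g t).
Proof.
move=> K10 K20 F G t tt; have /andP[t0 t16] := tt.
have t1 : t <= 1 by lra.
have n1 := normc_ge0 l1; have n2 := normc_ge0 l2.
have {}F := F t tt; have {}G := G t tt; move: F G.
set e1 := f t - 1 - _; set e2 := g t - 1 - _ => F G.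
have -> : f t * g t - 1 - (l1 + l2) * t%:C =
   l1 * l2 * t%:C ^+ 2 + e1 * (1 + l2 * t%:C + e2) + e2 * (1 + l1 * t%:C).
  by rewrite /e1 /e2; ring.
have nt : nc t%:C = t by rewrite normc_real ger0_norm.
have tt2 : t ^+ 2 <= 1 by rewrite expr_le1.
have t20 := sqr_ge0 t.
have b1 (l : C) : nc (1 + l * t%:C) <= 1 + nc l.
  apply: le_trans (normcD _ _) _; rewrite Normc.normc1 lerD2l Normc.normcM nt.
  by rewrite ler_piMr// normc_ge0.
apply: le_trans (normcD _ _) _; rewrite [leRHS]mulrDl.
apply: lerD; last first.
  by rewrite Normc.normcM mulrAC; apply: ler_pM; rewrite ?normc_ge0.
apply: le_trans (normcD _ _) _; rewrite [leRHS]mulrDl; apply: lerD.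
  by rewrite 2!Normc.normcM normcX nt.
rewrite Normc.normcM mulrAC; apply: ler_pM; rewrite ?normc_ge0//.
apply: le_trans (normcD _ _) _; apply: lerD => //.
by apply: le_trans G _; rewrite ler_piMr.
Qed.

Let so_const_ge0 (l1 l2 : C) (K1 K2 : R) : 0 <= K1 -> 0 <= K2 ->
  0 <= nc l1 * nc l2 + K1 * (1 + nc l2 + K2) + K2 * (1 + nc l1).
Proof.
move=> K10 K20; have h1 := normc_ge0 l1; have h2 := normc_ge0 l2.
by rewrite !addr_ge0// mulr_ge0// !addr_ge0.
Qed.

(** [K'] is chosen before [f], hence it is independent of [m] when [f] is [dirichlet m]. *)
Lemma so_exp (l : C) (K : R) n : 0 <= K -> exists2 K', 0 <= K' &
  forall f, so l K f -> so (n%:R * l) K' (fun t => f t ^+ n).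
Proof.
move=> K0; elim: n => [|n [K' K'0 IH]].
  by exists 0 => // f _ t _; rewrite expr0 !mul0r subr0 subrr Normc.normc0.
exists (nc l * nc (n%:R * l) + K * (1 + nc (n%:R * l) + K') + K' * (1 + nc l)).
  exact: so_const_ge0.
move=> f Hf t tt; have := so_mul K0 K'0 Hf (IH f Hf) tt.
have -> : n.+1%:R * l = l + n%:R * l by rewrite -[n.+1%:R]natr1 mulrDl mul1r addrC.
by rewrite -exprS.
Qed.


(** The frequencies [16 * j / m] have mean 8 and are at most 16, whatever [m] is. *)
Lemma so_dirichlet m : (0 < m)%N -> so (0 +i* 8)%C (3 * 16 ^+ 2) (dirichlet m).
Proof.
move=> m0 t /andP[t0 _]; have mr : 0 < m%:R :> R by rewrite ltr0n.
have m1r : 0 < m.+1%:R :> R by rewrite ltr0n.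
have sumj : \sum_(j < m.+1) (j%:R : R) = m.+1%:R * m%:R / 2.
  elim: (m) => [|p IH]; first by rewrite big_ord_recr big_ord0 /=; ring.
  by rewrite big_ord_recr /= IH -!natr1; field.
pose w (j : nat) : C := (0 +i* (j%:R * (16 * t / m%:R)))%C.
have sumw : \sum_(j < m.+1) w j = (m.+1%:R)%:C * ((0 +i* 8)%C * t%:C).
  have -> : \sum_(j < m.+1) w j = (0 +i* (\sum_(j < m.+1) j%:R * (16 * t / m%:R)))%C.
    elim: (m.+1) => [|p IH]; first by rewrite !big_ord0.
    by rewrite !big_ord_recr /= IH /w; apply/eqP; rewrite eq_complex /= addr0 !eqxx.
  rewrite -mulr_suml sumj; apply/eqP; rewrite eq_complex /=.
  by apply/andP; split; apply/eqP; [ring|field; rewrite gt_eqF].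
have -> : dirichlet m t - 1 - (0 +i* 8)%C * t%:C =
   (m.+1%:R^-1)%:C * \sum_(j < m.+1) (expi (j%:R * (16 * t / m%:R)) - 1 - w j).
  rewrite !sumrB sumw sumr_const card_ord /dirichlet.
  under eq_bigr do rewrite expiX.
  have E : (m.+1%:R^-1)%:C * (m.+1%:R)%:C = 1 :> C.
    by rewrite -rmorphM mulVf ?gt_eqF// rmorph1.
  have E2 : m.+1%:R = (m.+1%:R)%:C :> C by rewrite rmorph_nat.
  rewrite E2; move: (m.+1%:R^-1)%:C (m.+1%:R)%:C E => p q E.
  move: (\sum_(i < _) _) (_ * t%:C) => u v.
  by transitivity (p * u - p * q - p * q * v); [rewrite E mul1r|ring].
rewrite Normc.normcM normc_real ger0_norm ?invr_ge0// ler_pdivrMl//.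
apply: le_trans (normc_sum m.+1 (fun j => expi (j%:R * (16 * t / m%:R)) - 1 - w j)) _.
apply: (@le_trans _ _ (\sum_(j < m.+1) 3 * 16 ^+ 2 * t ^+ 2)); last first.
  by rewrite sumr_const card_ord -[_ *+ m.+1]mulr_natl.
apply: ler_sum => j _; apply: le_trans (expi_so _) _.
rewrite -[leRHS]mulrA -[X in _ <= _ * X]exprMn ler_wpM2l//.
have jm : j%:R <= m%:R :> R by rewrite ler_nat -ltnS.
rewrite lerXn2r ?nnegrE//; first by rewrite mulr_ge0// divr_ge0// mulr_ge0.
  by rewrite mulr_ge0.
by rewrite mulrA ler_pdivrMr// mulrC ler_wpM2l// mulr_ge0.
Qed.

Lemma so_logistic (c : C) k : exists2 K : R, 0 <= K &
  so (c * (4 ^+ k)%:C) K (fun t => 1 + c * (logistic k t)%:C).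
Proof.
have [K K0 H] := logistic_so k; exists (nc c * K); first by rewrite mulr_ge0 ?normc_ge0.
move=> t /andP[t0 t16].
have -> : 1 + c * (logistic k t)%:C - 1 - c * (4 ^+ k)%:C * t%:C =
    c * (logistic k t - 4 ^+ k * t)%:C by rewrite rmorphB rmorphM /=; ring.
rewrite Normc.normcM normc_real -mulrA ler_wpM2l ?normc_ge0// H// t0 /=.
by lra.
Qed.

(* Its frequencies are bounded by a multiple of [2 ^ k], but its derivative at
   [0] is of order [4 ^ k], and still its modulus is at most 1 for [t >= 0]. *)
Definition base (c : C) k m t : C :=
  expi ((2 ^ k)%:R * t) * (1 + c * (logistic k t)%:C) * dirichlet m t ^+ (2 ^ k).

(** The slopes add up: [2 ^ k] from the leading exponential, [8 * 2 ^ k] from the power of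
    [dirichlet], and [c * 4 ^ k]. The constant is chosen before [m]. *)
Lemma base_so c k : exists2 K : R, 0 <= K & forall m, (0 < m)%N ->
  so ((0 +i* (9 * (2 ^ k)%:R))%C + c * (4 ^+ k)%:C) K (base c k m).
Proof.
have [K1 K10 H1] := so_logistic c k.
have K20 : 0 <= 3 * 16 ^+ 2 :> R by rewrite mulr_ge0 ?exprn_ge0.
have [K2 {}K20 H2] := so_exp (0 +i* 8)%C (2 ^ k) K20.
have K30 : 0 <= 3 * (2 ^ k)%:R ^+ 2 :> R by rewrite mulr_ge0 ?sqr_ge0.
have H3 := so_mul K30 K10 (so_expi (2 ^ k)%:R) H1.
set K4 := _ + _ * (1 + _) in H3.
have K40 : 0 <= K4.
  exact: so_const_ge0.
eexists; last first.
  move=> m m0; have H5 := so_mul K40 K20 H3 (H2 _ (so_dirichlet m0)).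
  move=> t tt; have := H5 t tt; set K5 := (_ + _ * (1 + _)).
  apply: le_trans; rewrite le_eqVlt; apply/orP; left; apply/eqP; congr nc.
  congr (_ - _ * _).
  rewrite [in RHS]addrAC; congr (_ + _).
  by apply/eqP; rewrite eq_complex; case: (c) => u v; 
     rewrite -(rmorph_nat (real_complex R)) /=; apply/andP; split; apply/eqP; ring.
exact: so_const_ge0.
Qed.

Lemma logistic_factor_le (c : C) k t : nc c <= 2 ->
  nc (1 + c * (logistic k t)%:C) <= 8 ^+ (2 ^ k).
Proof.
move=> c2; apply: le_trans (normcD _ _) _.
rewrite Normc.normc1 Normc.normcM normc_real.
have := logistic_bound k t; have x0 := normr_ge0 (logistic k t).
have M8 : 8 <= 8 ^+ (2 ^ k) :> R by apply: ler_eXnr; rewrite ?expn_gt0 ?ler1n.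
have : nc c * `|logistic k t| <= 2 * `|logistic k t| by rewrite ler_wpM2r.
lra.
Qed.

Lemma base_le (c : C) k m t : nc c <= 2 -> nc (base c k m t) <= 8 ^+ (2 ^ k).
Proof.
move=> c2; rewrite !Normc.normcM normc_expi mul1r normcX.
rewrite -[leRHS]mulr1; apply: ler_pM; rewrite ?exprn_ge0 ?normc_ge0//.
  exact: logistic_factor_le.
by rewrite exprn_ile1 ?normc_ge0// dirichlet_le1.
Qed.

(** On [[0, pi]] the middle factor is a convex combination of 1 and [expi ph]. Beyond [pi] it is at
    most [8 ^+ (2 ^ k)], which the same power of [dirichlet_small] cancels. *)
Lemma base_le1 (ph : R) k m t : (0 < m)%N -> 0 <= t -> 16 * t <= m%:R ->
  nc (base (expi ph - 1) k m t) <= 1.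
Proof.
move=> m0 t0 tm; rewrite !Normc.normcM normc_expi mul1r normcX.
set c := expi ph - 1.
have c2 : nc c <= 2.
  by apply: le_trans (normcD _ _) _; rewrite normcN normc_expi Normc.normc1.
have [tp|pt] := lerP t pi.
  have lt : 0 <= logistic k t <= 1 by rewrite logistic_itv// t0.
  rewrite mulr_ile1 ?normc_ge0 ?exprn_ge0 ?normc_ge0//; last first.
    by rewrite exprn_ile1 ?normc_ge0// dirichlet_le1.
  have -> : 1 + c * (logistic k t)%:C =
      (1 - logistic k t)%:C + (logistic k t)%:C * expi ph.
    by rewrite rmorphB rmorph1 /c; ring.
  move: lt => /andP[l0 l1].
  apply: le_trans (normcD _ _) _; rewrite Normc.normcM normc_expi mulr1 !normc_real.
  by rewrite !ger0_norm ?subr_ge0// subrK.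
have p2 : 2 <= t by apply: le_trans (pi_ge2 R) (ltW pt).
have d8 := dirichlet_small m0 p2 tm.
have h8 := logistic_factor_le k t c2.
have -> : 1 = 8 ^+ (2 ^ k) * 8^-1 ^+ (2 ^ k) :> R by rewrite -exprMn mulfV// expr1n.
apply: ler_pM; rewrite ?exprn_ge0 ?normc_ge0//.
by rewrite lerXn2r ?nnegrE ?normc_ge0.
Qed.

(** Multiplying [logistic k] by [expi (2 ^ k * t)] removes its negative frequencies and leaves a
    polynomial in [expi t]. *)
Fixpoint logistic_poly k : {poly C} :=
  if k is k'.+1 then
    4%:R *: (logistic_poly k' * ('X^(2 ^ k') - logistic_poly k'))
  else (2 * 'i)^-1 *: ('X^2 - 1).

Lemma logistic_polyE k t :
  (logistic_poly k).[expi t] = expi ((2 ^ k)%:R * t) * (logistic k t)%:C.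
Proof.
elim: k => [|k IH] /=.
  rewrite hornerZ hornerD hornerXn hornerN hornerC expiX mul1r.
  have i2 : 2 * 'i != 0 :> C by rewrite mulf_neq0 ?pnatr_eq0// neq0Ci.
  apply: (mulfI i2); rewrite mulrA mulfV// mul1r.
  have -> : 2%:R * t = t *+ 2 by rewrite mulr_natl.
  rewrite imagE /expi cos_mulr2n sin_mulr2n cos2sin2.
  by apply/eqP; rewrite eq_complex /=; apply/andP; split; apply/eqP; ring.
rewrite hornerZ hornerM hornerD hornerN hornerXn IH expiX.
have -> : expi ((2 ^ k.+1)%:R * t) = expi ((2 ^ k)%:R * t) * expi ((2 ^ k)%:R * t).
  by rewrite -expiD expnS natrM; congr expi; ring.
rewrite !rmorphM rmorphB /= rmorph_nat rmorph1; ring.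
Qed.

Lemma size_logistic_poly k : (size (logistic_poly k) <= (2 ^ k.+1).+1)%N.
Proof.
elim: k => [|k IH] /=.
  by apply: leq_trans (size_scale_leq _ _) _; rewrite size_XnsubC.
apply: leq_trans (size_scale_leq _ _) _; apply: leq_trans (size_polyMleq _ _) _.
have h : (size ('X^(2 ^ k) - logistic_poly k)%R <= (2 ^ k.+1).+1)%N.
  apply: leq_trans (size_polyD _ _) _; rewrite size_polyN geq_max IH andbT.
  by rewrite size_polyXn ltnS leq_exp2l.
rewrite [(2 ^ k.+2)%N]expnS.
move: IH h; move: (size _) (size _) (2 ^ k.+1)%N => u v w; lia.
Qed.

(** In the variable [expi (t / m)] the frequencies [16 * j / m] of [dirichlet] become integers. The
    factors have degrees at most [2 * 2 ^ k * m] and [16 * 2 ^ k * m]. *)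
Definition base_poly (c : C) k m : {poly C} :=
  (('X^(2 ^ k) + c *: logistic_poly k) \Po 'X^m) *
  ((m.+1%:R^-1)%:C *: \sum_(j < m.+1) 'X^(16 * j)) ^+ (2 ^ k).

Lemma base_polyE c k m t : (0 < m)%N ->
  (base_poly c k m).[expi (t / m%:R)] = base c k m t.
Proof.
move=> m0; have mr : 0 < m%:R :> R by rewrite ltr0n.
rewrite /base_poly /base hornerM horner_exp hornerZ horner_comp hornerXn expiX.
have -> : m%:R * (t / m%:R) = t by field; rewrite gt_eqF.
rewrite hornerD hornerXn hornerZ logistic_polyE expiX; congr (_ * (_ * _) ^+ _); first ring.
rewrite horner_sum; apply: eq_bigr => j _; rewrite hornerXn expiX expiX; congr expi.
by rewrite natrM; ring.
Qed.

Lemma size_base_poly c k m : (size (base_poly c k m) <= (18 * 2 ^ k * m).+1)%N.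
Proof.
apply: leq_trans (size_polyMleq _ _) _.
have h1 : (size (('X^(2 ^ k) + c *: logistic_poly k) \Po 'X^m)%R <= (2 ^ k.+1 * m).+1)%N.
  apply: leq_trans (size_comp_poly_leq _ _) _; rewrite size_polyXn ltnS leq_mul2r.
  apply/orP; right.
  have : (size ('X^(2 ^ k) + c *: logistic_poly k)%R <= (2 ^ k.+1).+1)%N.
    apply: leq_trans (size_polyD _ _) _; rewrite geq_max size_polyXn ltnS leq_exp2l//=.
    by rewrite leqnSn (leq_trans (size_scale_leq _ _))// size_logistic_poly.
  by move: (size _) => u; lia.
have h2 : (size (((m.+1%:R^-1)%:C *: \sum_(j < m.+1) 'X^(16 * j)) ^+ (2 ^ k) : {poly C})
    <= (16 * m * 2 ^ k).+1)%N.
  apply: leq_trans (size_poly_exp_leq _ _) _; rewrite ltnS leq_mul2r; apply/orP; right.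
  have : (size ((m.+1%:R^-1)%:C *: \sum_(j < m.+1) 'X^(16 * j) : {poly C}) <= (16 * m).+1)%N.
    apply: leq_trans (size_scale_leq _ _) _; apply: leq_trans (size_sum _ _ _) _.
    by apply/bigmax_leqP => j _; rewrite size_polyXn ltnS leq_mul2l -ltnS ltn_ord.
  by move: (size _) => u; lia.
move: h1 h2; set u := size (polyseq (_ \Po _)); set v := size (polyseq (_ ^+ _)).
by move: u v => u v; rewrite [(2 ^ k.+1)%N]expnS; move: (2 ^ k)%N => w; nia.
Qed.

(* The approximant is a power of [base]. The weight [1 + mu] absorbs the
   frequencies beyond the period of [dirichlet]. *)
Lemma exp_approx (a : nat) (eta : R) : 0 < eta -> exists q (p : {poly C}),
  [/\ (0 < q)%N, (size p <= q.+1)%N & forall mu, 0 <= mu ->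
    nc (expi (a%:R * mu) - p.[expi (mu / q%:R)]) ^+ 2 <= eta + eta * mu].
Proof.
move=> eta0.
pose F : R := 3 * (18 * a%:R - 9) ^+ 2.
have F0 : 0 <= F by rewrite mulr_ge0 ?sqr_ge0.
pose s := Num.min 1 eta.
have s0 : 0 < s by rewrite lt_min ltr01.
have s1 : s <= 1 by rewrite ge_min lexx.
have seta : s ^+ 2 <= eta.
  apply: (@le_trans _ _ s); last by rewrite ge_min lexx orbT.
  by rewrite expr2 ler_piMl// ltW.
(* Beyond [M0] the weight [eta * mu] exceeds 4, the trivial bound of the squared error. *)
pose M0 := 4 / eta.
have M00 : 0 < M0 by rewrite divr_gt0.
pose k := (Num.trunc (2 * F * M0 / s)).+1.
pose N := (2 ^ k)%N.
have N0 : (0 < N)%N by rewrite expn_gt0.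
have Nr : 0 < N%:R :> R by rewrite ltr0n.
have Nr1 : 1 <= N%:R :> R by rewrite ler1n.
have FN : F * M0 / N%:R <= s / 2.
  rewrite ler_pdivrMr//.
  have h1 : 2 * F * M0 / s < N%:R.
    by apply: lt_trans (truncnS_gt _) _; rewrite ltr_nat ltn_expl.
  rewrite ltr_pdivrMr// in h1; lra.
(* Tuned so that [9 * N + N ^+ 2 * ph = w]: the slope of [base] then differs from that of
   [expi (w * t)] only by the second-order error of [c], at most [F] after multiplication by
   [N ^+ 2]. *)
pose ph : R := (18 * a%:R - 9) / N%:R.
pose c := expi ph - 1.
have c2 : nc c <= 2.
  by apply: le_trans (normcD _ _) _; rewrite normcN normc_expi Normc.normc1.
pose w := 18 * N%:R * a%:R : R.
have [K K0 HK] := base_so c k.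
pose K' := K + 3 * w ^+ 2.
have K'0 : 0 <= K' by rewrite addr_ge0// mulr_ge0 ?sqr_ge0.
pose n := (Num.trunc (2 * K' * M0 ^+ 2 / s + M0)).+1.
have nr : 0 < n%:R :> R by rewrite ltr0n.
have nbig : 2 * K' * M0 ^+ 2 / s + M0 < n%:R by exact: truncnS_gt.
have q0' : 0 <= 2 * K' * M0 ^+ 2 / s.
  by rewrite divr_ge0 ?(ltW s0)// mulr_ge0 ?sqr_ge0// mulr_ge0.
have nM : M0 < n%:R by lra.
have Kn : K' * M0 ^+ 2 / n%:R <= s / 2.
  rewrite ler_pdivrMr//.
  have : 2 * K' * M0 ^+ 2 / s < n%:R by lra.
  rewrite ltr_pdivrMr//; lra.
pose E : R := 8 ^+ (N * n).
have E0 : 0 <= E by exact: exprn_ge0.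
(* [m] comes last, after [n], since neither [K'] nor [n] depends on it. Where [16 * t > m] the error
   is at most [1 + E], and its square is below [eta * m <= eta * mu]. *)
pose m := (Num.trunc ((1 + E) ^+ 2 / eta)).+1.
have mr : 0 < m%:R :> R by rewrite ltr0n.
have mbig : (1 + E) ^+ 2 <= eta * m%:R.
  by rewrite mulrC -ler_pdivrMr// ltW// truncnS_gt.
exists (18 * N * m * n)%N, (base_poly c k m ^+ n); split.
- by rewrite !muln_gt0 N0.
- apply: leq_trans (size_poly_exp_leq _ _) _; rewrite ltnS leq_mul2r; apply/orP; right.
  have pr u M : (u <= M.+1)%N -> (u.-1 <= M)%N by case: u.
  exact/pr/size_base_poly.
move=> mu mu0; pose t := mu / (18 * N%:R * n%:R).
have t0 : 0 <= t by rewrite divr_ge0// !mulr_ge0.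
have -> : mu / (18 * N * m * n)%:R = t / m%:R.
  by rewrite /t !natrM; field; rewrite !gt_eqF.
have muE : mu = 18 * N%:R * n%:R * t by rewrite /t; field; rewrite !gt_eqF.
have -> : expi (a%:R * mu) = expi (w * t) ^+ n.
  by rewrite expiX; congr expi; rewrite muE /w; ring.
rewrite horner_exp base_polyE//.
have e1 : nc (expi (w * t)) <= 1 by rewrite normc_expi.
have le2 : nc (base c k m t ^+ n) <= 1 ->
    nc (expi (w * t) ^+ n - base c k m t ^+ n) ^+ 2 <= 4.
  move=> b1; have -> : 4 = 2 ^+ 2 :> R by ring.
  rewrite ler_sqr ?nnegrE ?normc_ge0//; apply: le_trans (normcD _ _) _.
  by rewrite normcN normcX normc_expi expr1n; lra.
have etamu : 0 <= eta * mu by rewrite mulr_ge0// ltW.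
have [tm|mt] := lerP (16 * t) m%:R; last first.
  apply: (@le_trans _ _ ((1 + E) ^+ 2)).
    rewrite ler_sqr ?nnegrE ?normc_ge0 ?addr_ge0//; apply: le_trans (normcD _ _) _.
    rewrite normcN normcX normc_expi expr1n lerD2l normcX /E exprM.
    by rewrite lerXn2r ?nnegrE ?normc_ge0 ?exprn_ge0// base_le.
  apply: le_trans mbig _.
  have : m%:R <= mu.
    rewrite muE; apply: (le_trans (ltW mt)).
    rewrite ler_wpM2r//.
    have : 1 * 1 <= N%:R * n%:R :> R by apply: ler_pM => //; rewrite ler1n.
    lra.
  move=> h; have := ler_wpM2l (ltW eta0) h; lra.
have b1 : nc (base c k m t) <= 1 by exact: base_le1.
have bn1 : nc (base c k m t ^+ n) <= 1 by rewrite normcX exprn_ile1 ?normc_ge0.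
have [muM|Mmu] := lerP mu M0; last first.
  apply: le_trans (le2 bn1) _.
  have : 4 <= eta * mu; last by lra.
  by rewrite mulrC -ler_pdivrMr// ltW.
apply: (@le_trans _ _ (s ^+ 2)); last by lra.
rewrite ler_sqr ?nnegrE ?normc_ge0 ?(ltW s0)//.
apply: le_trans (normcX_sub_le n e1 b1) _.
have t16 : t <= 16^-1.
  rewrite ler_pdivrMr ?mulr_gt0//.
  have : n%:R * 1 <= n%:R * N%:R :> R by rewrite ler_wpM2l.
  lra.
have tt : 0 <= t <= 16^-1 by rewrite t0.
have S1 := HK m (ltn0Sn _) t tt.
have S2 := so_expi w tt.
pose l1 := (0 +i* (9 * (2 ^ k)%:R))%C + c * (4 ^+ k)%:C.
have lF : nc ((0 +i* w)%C - l1) <= F.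
  have -> : (0 +i* w)%C - l1 = - ((N%:R ^+ 2)%:C * (c - (0 +i* ph)%C)).
    have E4 : 4 ^+ k = N%:R ^+ 2 :> R.
      by rewrite /N natrX -exprM mulnC exprM; congr (_ ^+ k); ring.
    rewrite /l1 E4 -/N /w /ph; move: (c) => [u v]; apply/eqP; rewrite eq_complex /=.
    by apply/andP; split; apply/eqP; field; rewrite gt_eqF.
  rewrite normcN Normc.normcM normc_real ger0_norm ?sqr_ge0//.
  apply: (@le_trans _ _ (N%:R ^+ 2 * (3 * ph ^+ 2))).
    by rewrite ler_wpM2l ?sqr_ge0// expi_so.
  by rewrite /ph /F le_eqVlt; apply/orP; left; apply/eqP; field; rewrite gt_eqF.
have D : nc (expi (w * t) - base c k m t) <= K' * t ^+ 2 + F * t.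
  have -> : expi (w * t) - base c k m t =
     (expi (w * t) - 1 - (0 +i* w)%C * t%:C) - (base c k m t - 1 - l1 * t%:C)
     + ((0 +i* w)%C - l1) * t%:C by ring.
  apply: le_trans (normcD _ _) _; apply: lerD; last first.
    by rewrite Normc.normcM normc_real ger0_norm// ler_wpM2r.
  apply: le_trans (normcD _ _) _; rewrite normcN /K' [leRHS]mulrDl addrC.
  by apply: lerD.
apply: le_trans (ler_wpM2l (ltW nr) D) _.
have -> : n%:R * (K' * t ^+ 2 + F * t) =
    K' * mu ^+ 2 / n%:R / (18 * N%:R) ^+ 2 + F * mu / N%:R / 18.
  by rewrite /t; field; rewrite !gt_eqF.
have h1 : K' * mu ^+ 2 / n%:R / (18 * N%:R) ^+ 2 <= K' * M0 ^+ 2 / n%:R.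
  apply: (@le_trans _ _ (K' * mu ^+ 2 / n%:R)).
    rewrite ler_pdivrMr ?exprn_gt0 ?mulr_gt0// ler_peMr//.
      by rewrite divr_ge0// mulr_ge0 ?sqr_ge0.
    by rewrite exprn_ege1//; lra.
  by rewrite ler_wpM2r ?invr_ge0// ler_wpM2l// ler_sqr ?nnegrE// ltW.
have h2 : F * mu / N%:R / 18 <= F * M0 / N%:R.
  apply: (@le_trans _ _ (F * mu / N%:R)).
    have y0 : 0 <= F * mu / N%:R by rewrite divr_ge0// mulr_ge0.
    by clear -y0; lra.
  by rewrite ler_wpM2r ?invr_ge0// ler_wpM2l.
clear -h1 h2 FN Kn; lra.
Qed.

End SymbolApproximation.

(** * Observability in a fixed time *)

Section ShortTime.
Context {R : realType} (S : obs_system R).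
Local Notation X := (obs_X S).
Local Notation D := (@obs_D _ S).
Local Notation A := (@obs_A _ S).
Local Notation U := (@obs_U _ S).
Local Notation C := (@obs_C _ S).
Implicit Types (x y z : X) (T h : R).

Lemma riemann_output_cvg_family n (x : nat -> X) (T : nat -> R) (v : nat -> nat) (d : R) :
  0 < d -> (forall i, (i < n)%N -> [/\ D (x i), 0 < T i & (0 < v i)%N]) ->
  exists M1, forall M, (M1 <= M)%N -> forall i, (i < n)%N ->
    `|out_energy (T i) (x i) - riemann_output (x i) (T i / (v i * M)%:R) (v i * M)| <= d.
Proof.
move=> d0; elim: n => [|n IH] Hx; first by exists 0%N.
have [|M1 H1] := IH; first by move=> i /ltnW /Hx.
have [Dn Tn vn] := Hx n (ltnSn n).
have [N0 HN] := riemann_output_cvg Dn Tn d0.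
exists (maxn M1 N0) => M; rewrite geq_max => /andP[M1M N0M] i.
rewrite ltnS leq_eqVlt => /predU1P[->|]; last exact: H1.
by have [] := HN (v n * M)%N (leq_trans N0M (leq_pmull M vn)).
Qed.

(** Limit of inequalities between Riemann sums. The multiplicities [u] and [v i] allow intervals of
    different lengths to share one step. *)
Lemma out_energy_transfer n (x : nat -> X) (Q T : nat -> R) (v : nat -> nat)
    y (T0 : R) (u : nat) :
  D y -> 0 < T0 -> (0 < u)%N ->
  (forall i, (i < n)%N -> [/\ D (x i), 0 < T i, 0 <= Q i & (0 < v i)%N]) ->
  (forall M, (0 < M)%N -> riemann_output y (T0 / (u * M)%:R) (u * M) <=
     \sum_(i < n) Q i * riemann_output (x i) (T i / (v i * M)%:R) (v i * M)) ->
  out_energy T0 y <= \sum_(i < n) Q i * out_energy (T i) (x i).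
Proof.
move=> Dy T00 u0 Hx H; apply/ler_addgt0Pr => e e0.
pose q := \sum_(i < n) Q i + 1.
have Q0 : 0 <= \sum_(i < n) Q i by apply: sumr_ge0 => i _; have [] := Hx i (ltn_ord i).
have q0 : 0 < q by rewrite ltr_wpDl.
pose d := e / (2 * q).
have d0 : 0 < d by rewrite divr_gt0// mulr_gt0.
have e20 : 0 < e / 2 by rewrite divr_gt0.
have [|M1 H1] := @riemann_output_cvg_family n x T v d d0.
  by move=> i /Hx[].
have [N0 HN] := riemann_output_cvg Dy T00 e20.
pose M := maxn M1 N0.+1.
have M0 : (0 < M)%N by rewrite leq_max orbT.
have NM : (N0 <= u * M)%N.
  apply: leq_trans (leq_pmull M u0); apply: leq_trans (leqnSn _) _.
  by rewrite leq_max leqnn orbT.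
have [_] := HN _ NM; rewrite ler_norml => /andP[_ E1].
have E2 := H M M0.
have E3 : \sum_(i < n) Q i * riemann_output (x i) (T i / (v i * M)%:R) (v i * M) <=
    \sum_(i < n) Q i * out_energy (T i) (x i) + (\sum_(i < n) Q i) * d.
  rewrite mulr_suml -big_split /=; apply: ler_sum => i _.
  have [_ _ Qi _] := Hx i (ltn_ord i); rewrite -mulrDr ler_wpM2l//.
  have := H1 M (leq_maxl _ _) i (ltn_ord i); rewrite ler_norml => /andP[h _]; lra.
have E4 : (\sum_(i < n) Q i) * d <= e / 2.
  have : q * d = e / 2 by rewrite /d; field; rewrite gt_eqF.
  rewrite /q; lra.
lra.
Qed.

Lemma out_energyD x y T : D x -> D y -> 0 < T ->
  out_energy T (x + y) <= 2 * out_energy T x + 2 * out_energy T y.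
Proof.
move=> Dx Dy T0.
have := @out_energy_transfer 2 (fun i => if i is 0 then x else y) (fun=> 2) (fun=> T)
  (fun=> 1%N) (x + y) T 1 (domD Dx Dy) T0 isT.
rewrite !big_ord_recr !big_ord0 /= !add0r; apply.
  by move=> [|i] _.
move=> M M0; rewrite !big_ord_recr !big_ord0 /= !add0r mul1n /riemann_output.
rewrite !(mulrCA 2) -mulrDr ler_wpM2l ?divr_ge0 ?(ltW T0)// !mulr_sumr -big_split /=.
apply: ler_sum => j _; rewrite /output_sq linearD /=.
have Dxj := (U_dom (j%:R * (T / M%:R)) Dx).1; have Dyj := (U_dom (j%:R * (T / M%:R)) Dy).1.
by rewrite (lin_onD (@C_lin _ S))//; exact: rnormD_sq.
Qed.

Lemma out_energy_cat n z : D z -> (0 < n)%N ->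
  out_energy n%:R z <= \sum_(a < n) out_energy 1 (U a%:R z).
Proof.
move=> Dz n0; have nr : 0 < n%:R :> R by rewrite ltr0n.
have := @out_energy_transfer n (fun a => U a%:R z) (fun=> 1) (fun=> 1)
  (fun=> 1%N) z n%:R n Dz nr n0.
under eq_bigr do rewrite mul1r.
apply; first by move=> a _; split=> //; exact: (U_dom _ Dz).1.
move=> M M0; have Mr : 0 < M%:R :> R by rewrite ltr0n.
have -> : n%:R / (n * M)%:R = 1 / M%:R :> R by rewrite natrM; field; rewrite !gt_eqF.
under eq_bigr do rewrite mul1r mul1n.
rewrite /riemann_output -(sum_ord_mul n M (fun l => output_sq z (l%:R * (1 / M%:R)))).
rewrite mulr_sumr; apply: ler_sum => a _; rewrite ler_wpM2l ?divr_ge0//.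
apply: ler_sum => j _; rewrite /output_sq -U_add.
suff -> : (a * M + j)%:R * (1 / M%:R) = j%:R * (1 / M%:R) + a%:R :> R by [].
by rewrite natrD natrM; field; rewrite gt_eqF.
Qed.

(** As [n <= q.+1], the translates reach at most time 1, so the output over [[0, 1]] only involves
    times in [[0, 2]]. The coefficients enter by Cauchy-Schwarz. *)
Lemma out_energy_group_poly n (c : nat -> R[i]) q z : D z -> (0 < q)%N -> (n <= q.+1)%N ->
  out_energy 1 (group_poly n c q%:R^-1 z) <=
    n%:R * (\sum_(j < n) Normc.normc (c j) ^+ 2) * out_energy 2 z.
Proof.
move=> Dz q0 nq; have qr : 0 < q%:R :> R by rewrite ltr0n.
set K := n%:R * _.
have K0 : 0 <= K by rewrite mulr_ge0// sumr_ge0// => j _; exact: sqr_ge0.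
have Dy := group_poly_dom n c q%:R^-1 Dz.
have := @out_energy_transfer 1 (fun=> z) (fun=> K) (fun=> 2)
  (fun=> (2 * q)%N) _ 1 q Dy ltr01 q0.
rewrite big_ord_recr big_ord0 /= add0r; apply.
  by move=> i _; split=> //; rewrite muln_gt0.
move=> M M0; have Mr : 0 < M%:R :> R by rewrite ltr0n.
rewrite big_ord_recr big_ord0 /= add0r.
have -> : 2 / (2 * q * M)%:R = 1 / (q * M)%:R :> R.
  by rewrite !natrM; field; rewrite !gt_eqF.
set h := 1 / (q * M)%:R.
have h0 : 0 <= h by rewrite divr_ge0.
rewrite /riemann_output mulrCA ler_wpM2l//.
have pt (i : nat) : output_sq (group_poly n c q%:R^-1 z) (i%:R * h) <=
   n%:R * \sum_(j < n) Normc.normc (c j) ^+ 2 * output_sq z ((i + j * M)%:R * h).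
  have -> : output_sq (group_poly n c q%:R^-1 z) (i%:R * h) =
     rnorm (\sum_(j < n) c j *: C (U ((i + j * M)%:R * h) z)) ^+ 2.
    rewrite /output_sq -group_poly_comm /group_poly.
    rewrite (lin_on_sum (@C_lin _ S) (f := fun j => c j *: U (j%:R / q%:R) (U (i%:R * h) z))).
      congr (rnorm _ ^+ 2); apply: eq_bigr => j _; rewrite -U_add (lin_onZ (@C_lin _ S)).
        congr (_ *: C (U _ z)); rewrite /h natrD !natrM; field.
        by rewrite !gt_eqF.
      exact: (U_dom _ Dz).1.
    by move=> j _; apply: domZ; rewrite -U_add; exact: (U_dom _ Dz).1.
  apply: (@le_trans _ _ ((\sum_(j < n) Normc.normc (c j) * rnorm (C (U ((i + j * M)%:R * h) z))) ^+ 2)).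
    rewrite ler_sqr ?nnegrE ?rnorm_ge0//; last first.
      by apply: sumr_ge0 => j _; rewrite mulr_ge0 ?normc_ge0 ?rnorm_ge0.
    apply: le_trans (rnorm_sum _ (fun j => c j *: C (U ((i + j * M)%:R * h) z))) _.
    by apply: ler_sum => j _; rewrite rnormZ.
  apply: le_trans (sqr_sum_le n (fun j => Normc.normc (c j) * rnorm (C (U ((i + j * M)%:R * h) z)))) _.
  by rewrite ler_wpM2l//; apply: ler_sum => j _; rewrite exprMn.
apply: le_trans (ler_sum _ (fun (i : 'I_(q * M)) _ => pt i)) _.
rewrite -mulr_sumr exchange_big /= /K -mulrA ler_wpM2l// mulr_suml.
apply: ler_sum => j _; rewrite -mulr_sumr ler_wpM2l ?sqr_ge0//.
have jq : (j <= q)%N by rewrite -ltnS; exact: leq_trans (ltn_ord j) nq.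
(* The sample times of [[0, 2]] before, inside and after the translated unit interval; the outer two
   sums are nonnegative. *)
have -> : (2 * q * M)%N = (j * M + (q * M + (q - j) * M))%N.
  by rewrite mulnBl; have : (j * M <= q * M)%N by [rewrite leq_mul2r jq orbT|lia]; lia.
rewrite !big_split_ord /=.
set s1 := \sum_(i < j * M) _; set s3 := \sum_(i < (q - j) * M) _.
have s10 : 0 <= s1 by apply: sumr_ge0 => i _; exact: output_sq_ge0.
have s30 : 0 <= s3 by apply: sumr_ge0 => i _; exact: output_sq_ge0.
under eq_bigr do rewrite addnC.
lra.
Qed.

Lemma group_poly_widen n m (c : nat -> R[i]) d z : (n <= m)%N ->
  (forall j, (n <= j)%N -> c j = 0) -> group_poly m c d z = group_poly n c d z.
Proof.
move=> /subnKC <- c0; rewrite /group_poly big_split_ord /=.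
by rewrite [X in _ + X]big1 ?addr0// => j _; rewrite c0 ?leq_addr// scale0r.
Qed.

Lemma group_poly_coefD n (p r : {poly R[i]}) d z :
  group_poly n (fun j => (p + r)`_j) d z =
  group_poly n (fun j => p`_j) d z + group_poly n (fun j => r`_j) d z.
Proof.
rewrite /group_poly -big_split /=; apply: eq_bigr => j _.
by rewrite coefD scalerDl.
Qed.

Lemma group_poly_coefXn n k d z : (k < n)%N ->
  group_poly n (fun j => ('X^k : {poly R[i]})`_j) d z = U (k%:R * d) z.
Proof.
move=> kn; rewrite /group_poly (bigD1 (Ordinal kn)) //= coefXn eqxx scale1r.
rewrite big1 ?addr0// => j jk; rewrite coefXn.
have -> : (j == k :> nat) = false by apply/negbTE; apply: contra jk => /eqP e; apply/eqP/val_inj.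
by rewrite scale0r.
Qed.

(** [exp_approx] replaces [U a] by a polynomial of the group with times in [[0, 1]]. For frequencies
    up to [L] the remainder is small in norm by [group_poly_le], hence in output by
    admissibility. *)
Lemma shifted_energy_le (a : nat) (L d : R) : 0 <= L -> 0 < d ->
  exists2 Q : R, 0 <= Q & forall z, D z -> z != 0 -> frequency z <= L ->
    out_energy 1 (U a%:R z) <= Q * out_energy 2 z + d * rnorm z ^+ 2.
Proof.
move=> L0 d0; have [C1 C10 HC] := admissible S (@ltr01 R).
(* The remainder costs [2 * C1 * (2 * eta + 4 * eta * L) = d]. *)
pose eta := d / (C1 * (4 + 8 * L)).
have L40 : 0 < 4 + 8 * L by lra.
have eta0 : 0 < eta by rewrite divr_gt0// mulr_gt0.
have [q [p [q0 sp Hp]]] := exp_approx a eta0.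
have qr : 0 < q%:R :> R by rewrite ltr0n.
pose r := 'X^(a * q) - p.
pose n := maxn (size p) (a * q).+1.
exists (2 * ((size p)%:R * \sum_(j < size p) Normc.normc (p`_j) ^+ 2)).
  by rewrite mulr_ge0// mulr_ge0// sumr_ge0// => j _; exact: sqr_ge0.
move=> z Dz z0 fL.
have zE : U a%:R z = group_poly (size p) (fun j => p`_j) q%:R^-1 z +
    group_poly n (fun j => r`_j) q%:R^-1 z.
  rewrite -(@group_poly_widen _ n (fun j => p`_j)) ?leq_maxl//; last first.
    by move=> j; exact: nth_default.
  rewrite -group_poly_coefD /r addrC subrK group_poly_coefXn ?leq_max ?leqnn ?orbT//.
  by congr (U _ z); rewrite natrM; field; rewrite gt_eqF.
rewrite zE; apply: le_trans (out_energyD _ _ ltr01) _; try exact: group_poly_dom.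
rewrite -!mulrA; apply: lerD.
  rewrite ler_pM2l// mulrA; exact: out_energy_group_poly.
have rle : rnorm (group_poly n (fun j => r`_j) q%:R^-1 z) ^+ 2 <=
    2 * eta * rnorm z ^+ 2 + 4 * eta * energy z.
  apply: group_poly_le => //; rewrite ?invr_gt0 ?(ltW eta0)//.
  move=> mu mu0.
  have -> : \sum_(j < n) r`_j * expi (j%:R * (q%:R^-1 * mu)) = r.[expi (mu / q%:R)].
    have sr : (size r <= n)%N.
      apply: leq_trans (size_polyD _ _) _; rewrite size_polyN size_polyXn.
      by rewrite /n maxnC.
    rewrite (horner_coef_wide _ sr); apply: eq_bigr => j _.
    by rewrite expiX [mu / _]mulrC.
  rewrite /r hornerD hornerN hornerXn expiX.
  have -> : (a * q)%:R * (mu / q%:R) = a%:R * mu.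
    by rewrite natrM; field; rewrite gt_eqF.
  exact: Hp.
rewrite frequencyE// in rle.
have := HC _ (group_poly_dom n (fun j => r`_j) q%:R^-1 Dz).
have h1 := ler_wpM2l (ltW C10) rle.
have h2 : 4 * eta * (frequency z * rnorm z ^+ 2) <= 4 * eta * (L * rnorm z ^+ 2).
  have e4 : 0 <= 4 * eta by lra.
  by apply: (ler_wpM2l e4); rewrite ler_wpM2r ?sqr_ge0.
have h3 := ler_wpM2l (ltW C10) h2.
have h4 : C1 * eta * (4 + 8 * L) = d by rewrite /eta; field; rewrite !gt_eqF.
have h5 : C1 * eta * (4 + 8 * L) * rnorm z ^+ 2 = d * rnorm z ^+ 2 by rewrite h4.
lra.
Qed.

Lemma long_energy_le (n : nat) (L d : R) : (0 < n)%N -> 0 <= L -> 0 < d ->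
  exists2 Q : R, 0 <= Q & forall z, D z -> z != 0 -> frequency z <= L ->
    out_energy n%:R z <= Q * out_energy 2 z + d * rnorm z ^+ 2.
Proof.
move=> n0 L0 d0; have nr : 0 < n%:R :> R by rewrite ltr0n.
suff [Q Q0 HQ] : exists2 Q : R, 0 <= Q & forall z, D z -> z != 0 -> frequency z <= L ->
    \sum_(a < n) out_energy 1 (U a%:R z) <=
      Q * out_energy 2 z + n%:R * (d / n%:R) * rnorm z ^+ 2.
  exists Q => // z Dz z0 fL; apply: le_trans (out_energy_cat Dz n0) _.
  by apply: le_trans (HQ z Dz z0 fL) _; rewrite mulrC [n%:R * _]mulrC divfK ?gt_eqF// mulrC.
have : 0 < d / n%:R by rewrite divr_gt0.
move: (d / n%:R) => dn dn0; elim: (n) => [|k [Q Q0 HQ]].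
  by exists 0 => // z Dz _ _; rewrite big_ord0 !mul0r addr0.
have [Q' Q'0 HQ'] := shifted_energy_le k L0 dn0.
exists (Q + Q'); first exact: addr_ge0.
move=> z Dz z0 fL; rewrite big_ord_recr /=.
apply: le_trans (lerD (HQ z Dz z0 fL) (HQ' z Dz z0 fL)) _.
by rewrite -natr1 le_eqVlt; apply/orP; left; apply/eqP; ring.
Qed.

(** Coercivity first gives observability in a time [n] depending on the level. [long_energy_le]
    reduces it to time 2, the remainder taking half of the constant. The level [4 * (L + 1)] stays
    positive when [L = 0]. *)
Lemma coercive_short_time (L e p : R) : 0 <= L -> 0 < e -> 0 < p ->
  coercive_below S (4 * (L + 1)) e p ->
  exists2 c : R, 0 < c & forall z, D z -> z != 0 -> frequency z <= L ->
    c * rnorm z ^+ 2 <= out_energy 2 z.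
Proof.
move=> L0 e0 p0 H.
pose n := (Num.trunc (480 / e)).+1.
have nr1 : 1 <= n%:R :> R by rewrite ler1n.
have nr : 0 < n%:R :> R by rewrite ltr0n.
have ne : 480 <= n%:R ^+ 2 * e.
  have h1 : 480 <= n%:R * e by rewrite -ler_pdivrMr// ltW// truncnS_gt.
  have : n%:R <= n%:R ^+ 2 :> R by rewrite expr2 ler_peMl.
  move=> h2; have := ler_wpM2r (ltW e0) h2; lra.
pose c := p * n%:R / 16.
have c0 : 0 < c by rewrite divr_gt0// mulr_gt0.
have c20 : 0 < c / 2 by rewrite divr_gt0.
have [Q Q0 HQ] := long_energy_le (ltn0Sn _ : (0 < n)%N) L0 c20.
exists (c / 2 / (Q + 1)); first by rewrite divr_gt0// ltr_wpDl.
move=> z Dz z0 fL.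
have L40 : 0 < 4 * (L + 1) by lra.
have h1 : c * rnorm z ^+ 2 <= out_energy n%:R z.
  by apply: (coercive_below_observable L40 e0 p0 nr H Dz z0 _ ne); lra.
have h2 := HQ z Dz z0 fL; have h3 := out_energy_ge0 2 z.
rewrite mulrAC ler_pdivrMr ?ltr_wpDl//; lra.
Qed.

End ShortTime.

(** * The equivalences *)

Section Equivalences.
Context {R : realType} (S : obs_system R).
Local Notation D := (@obs_D _ S).

Lemma coercive_with_below eps psi (L : R) : modulus eps -> modulus psi -> 0 <= L ->
  coercive_with S eps psi -> coercive_below S L (eps L) (psi L).
Proof.
move=> [_ edec _] [_ pdec _] L0 H x Dx x0 fx Ve.
have f0 := frequency_ge0 Dx.
apply: le_trans (H x Dx x0 _); first by rewrite ler_wpM2r ?sqr_ge0// pdec.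
by rewrite variance_ge0//= (lt_le_trans Ve)// edec.
Qed.

Lemma coercive_weakly_observable : spectrally_coercive S -> weakly_observable S.
Proof.
move=> [eps [psi [me mp H]]].
have [c Hc] : {c : nat -> R & forall n, 0 < c n /\ forall z, D z -> z != 0 ->
    frequency z <= n.+1%:R -> c n * rnorm z ^+ 2 <= out_energy 2 z}.
  apply: (@choice nat R (fun n c => 0 < c /\ forall z, D z -> z != 0 ->
    frequency z <= n.+1%:R -> c * rnorm z ^+ 2 <= out_energy 2 z)) => n.
  have L0 : 0 <= 4 * (n.+1%:R + 1) :> R by rewrite mulr_ge0// addr_ge0.
  have [_ _ epos] := me; have [_ _ ppos] := mp.
  have [c c0 Hc] := coercive_short_time (ler0n R n.+1) (epos _ L0) (ppos _ L0)
    (coercive_with_below me mp L0 H).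
  by exists c.
have [phi mphi Hphi] := modulus_below_seq (fun n => (Hc n).1).
exists 2 => //; exists phi => // z Dz z0.
have f0 := frequency_ge0 Dz.
rewrite output_energyE// lee_fin; apply: le_trans ((Hc (Num.trunc (frequency z))).2 z Dz z0 _).
  by rewrite ler_wpM2r ?sqr_ge0// Hphi.
by rewrite ltW// truncnS_gt.
Qed.

(** Coercivity involves no time, so [T] may depend on the level. A frequency [f] is treated at level
    [n = trunc f], for which [f <= n + 1]. *)
Lemma coercive_of_levels :
  (forall n : nat, exists T c : R, [/\ 0 < T, 0 < c & forall z, D z -> z != 0 ->
    frequency z <= n.+1%:R -> c * rnorm z ^+ 2 <= out_energy T z]) ->
  spectrally_coercive S.
Proof.
move=> H.
have [ep Hep] : {ep : nat -> R * R & forall n, [/\ 0 < (ep n).1, 0 < (ep n).2 &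
    coercive_below S n.+1%:R (ep n).1 (ep n).2]}.
  apply: (@choice nat (R * R)%type (fun n ep => [/\ 0 < ep.1, 0 < ep.2 &
    coercive_below S n.+1%:R ep.1 ep.2])) => n.
  have [T [c [T0 c0 HT]]] := H n.
  have [e [p [e0 p0 He]]] := observable_coercive_below T0 c0 HT.
  by exists (e, p).
have e0 n : 0 < (ep n).1 by have [] := Hep n.
have p0 n : 0 < (ep n).2 by have [] := Hep n.
have [eps me Heps] := modulus_below_seq e0.
have [psi mp Hpsi] := modulus_below_seq p0.
exists eps, psi; split=> // z Dz z0 /andP[_ Ve].
have f0 := frequency_ge0 Dz.
have [_ _ Hc] := Hep (Num.trunc (frequency z)).
apply: le_trans (Hc z Dz z0 _ _).
- by rewrite ler_wpM2r ?sqr_ge0// Hpsi.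
- by rewrite ltW// truncnS_gt.
- by rewrite (lt_le_trans Ve)// Heps.
Qed.

Lemma weakly_observable_coercive : weakly_observable S -> spectrally_coercive S.
Proof.
move=> [T T0 [psi [_ pdec ppos] H]]; apply: coercive_of_levels => n.
exists T, (psi n.+1%:R); split=> //; first exact: ppos.
move=> z Dz z0 fn; have f0 := frequency_ge0 Dz.
have := H z Dz z0; rewrite output_energyE// lee_fin; apply: le_trans.
by rewrite ler_wpM2r ?sqr_ge0// pdec.
Qed.

(** Since [obs_time] is increasing, the time attached to [n + 1] serves all lower frequencies, and
    [psi] is bounded below by its value at the largest argument. *)
Lemma weak_obs_inequality_coercive theta0 theta1 theta2 eps psi :
  0 < theta0 -> 0 < theta1 -> 0 < theta2 -> modulus eps -> modulus psi ->
  weak_obs_inequality theta0 theta1 theta2 S eps psi -> spectrally_coercive S.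
Proof.
move=> t0 t1 t2 me [_ pdec ppos] H; apply: coercive_of_levels => n.
pose T := obs_time theta0 theta1 eps n.+1%:R.
have [T0 _] := obs_timeP t0 t1 me (ler0n R n.+1).
have a0 := time_arg_ge0 t0 T0 (ler0n R n.+1).
exists T, (theta2 * psi (theta0 * (T^-1 + n.+1%:R))); split=> //.
  by rewrite mulr_gt0// ppos.
move=> z Dz z0 fn; have f0 := frequency_ge0 Dz.
have := H z Dz z0 T (obs_time_incr t0 t1 me f0 fn).
rewrite output_energyE// lee_fin; apply: le_trans.
rewrite ler_wpM2r ?sqr_ge0// ler_pM2l//; apply: pdec; first exact: time_arg_ge0.
by rewrite ler_pM2l// lerD2l.
Qed.

(** Apply [coercive_below_observable] at the level [L] where the moduli are evaluated: 4 is its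
    frequency ratio and 1/16 its output factor, a further factor [T >= 1] being dropped. *)
Lemma coercive_weak_obs_inequality (M : R) eps psi : 0 < M ->
  modulus eps -> modulus psi -> eps 0 <= M -> coercive_with S eps psi ->
  weak_obs_inequality 4 (M + 480) 16^-1 S eps psi.
Proof.
move=> M0 me mp eM H z Dz z0 T HT; have f0 := frequency_ge0 Dz.
have t10 : 0 < M + 480 by lra.
have t40 : 0 < 4 :> R by [].
have [S0 _] := obs_timeP t40 t10 me f0.
have T0 : 0 < T by apply: lt_le_trans HT.
move: HT; rewrite obs_time_le//.
have [_ edec epos] := me; have [_ _ ppos] := mp.
set L := 4 * _ => TL.
have L0 : 0 <= L := time_arg_ge0 t40 T0 f0.
have fL : 4 * frequency z <= L by rewrite /L ler_pM2l// lerDr invr_ge0 ltW.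
have Lp : 0 < L by rewrite mulr_gt0// ltr_pwDl ?invr_gt0.
have eL : eps L <= M by apply: le_trans eM; exact: edec.
have e0 := epos L L0; have p0 := ppos L L0.
(* For [T < 1] the product [T * eps L] would be at most [M], below [theta1]. *)
have T1 : 1 <= T.
  rewrite leNgt; apply/negP => Tlt.
  have : T * eps L <= 1 * M by apply: ler_pM => //; exact: ltW.
  lra.
have Te : 480 <= T ^+ 2 * eps L.
  have : T * eps L <= T ^+ 2 * eps L by rewrite ler_wpM2r ?(ltW e0)// expr2 ler_peMl// ltW.
  lra.
rewrite output_energyE// lee_fin.
apply: le_trans (coercive_below_observable Lp e0 p0 T0
  (coercive_with_below me mp L0 H) Dz z0 fL Te).
rewrite ler_wpM2r ?sqr_ge0//.
have : psi L <= psi L * T by rewrite ler_peMr// ltW.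
lra.
Qed.

(** Lowering [eps] only strengthens the premise of coercivity, so [eps] can be replaced by a modulus
    below [Num.min M eps]: the bound by [M] costs nothing in the equivalence. *)
Lemma coercive_exists_bounded (M : R) : 0 < M -> spectrally_coercive S ->
  exists eps psi, [/\ modulus eps, modulus psi, eps 0 <= M & coercive_with S eps psi].
Proof.
move=> M0 [eps [psi [me mp H]]]; have [ce edec epos] := me.
have [eps' me' le'] : exists2 eps', modulus eps' &
    forall x, 0 <= x -> eps' x <= Num.min M (eps x).
  apply: modulus_minorant => [x x0|x y x0 xy]; first by rewrite lt_min M0 epos.
  by rewrite le_min !ge_min lexx /= edec ?orbT.
exists eps', psi; split=> //.
  by have := le' 0 (lexx _); rewrite le_min => /andP[].
move=> z Dz z0 /andP[V0 Ve]; apply: H => //; rewrite V0 /=.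
apply: lt_le_trans Ve _.
by have := le' _ (frequency_ge0 Dz); rewrite le_min => /andP[].
Qed.

End Equivalences.

(* M only records what theta1 may depend on: every eps in the class is bounded
   by eps 0, and M = 1 gives three absolute constants. Constants uniform in all
   eps do not exist: for C the identity, psi = 1 and eps = M constant, the
   inequality at T = theta1 / M reads theta2 <= theta1 / M. *)
Theorem theorem2p1 (R : realType) :
  exists theta0 theta2 : R, [/\ 0 < theta0, 0 < theta2 &
  forall M : R, 0 < M ->
  exists theta1 : R, [/\ 0 < theta1,
    forall eps : R -> R, modulus eps ->
      (forall lambda : R, 0 <= lambda ->
         exists! T : R, solves_time_eq theta0 theta1 eps lambda T) /\
      (forall lambda1 lambda2 : R, 0 <= lambda1 -> lambda1 <= lambda2 ->
         obs_time theta0 theta1 eps lambda1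
           <= obs_time theta0 theta1 eps lambda2) &
    forall S : obs_system R,
      [/\ weakly_observable S <-> spectrally_coercive S,
          spectrally_coercive S <->
            (exists eps psi : R -> R,
               [/\ modulus eps, modulus psi &
                   weak_obs_inequality theta0 theta1 theta2 S eps psi]) &
          forall eps psi : R -> R, modulus eps -> modulus psi -> eps 0 <= M ->
            coercive_with S eps psi ->
            weak_obs_inequality theta0 theta1 theta2 S eps psi]]].
Proof.
exists 4, 16^-1; split; rewrite ?invr_gt0// => M M0; exists (M + 480).
have t1 : 0 < M + 480 by lra.
split=> //.
  move=> eps me; split=> [lambda l0|l1 l2 l10 l12].
    exact: time_eq_exists_unique.
  exact: obs_time_incr.
move=> S; split.
- by split; [exact: weakly_observable_coercive|exact: coercive_weakly_observable].
- split=> [/(coercive_exists_bounded M0)[eps [psi [me mp eM H]]]|[eps [psi [me mp H]]]].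
    by exists eps, psi; split=> //; exact: coercive_weak_obs_inequality.
  by apply: (weak_obs_inequality_coercive _ t1 _ me mp H); rewrite ?invr_gt0.
- by move=> eps psi me mp eM H; exact: coercive_weak_obs_inequality.
Qed.
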